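(* Let $d\ge2$ be an integer. There exists a constant $C=C(d)<\infty$ such that for every $\rho\in(0,1)$, every $x\in\mathbb{Z}^d$ and every $t>0$, $$\left\langle \mathbf{P}_{(X,\eta)}[\mathbf{X}_t=x]\,\middle|\,X=0\right\rangle_\rho\le\begin{cases}\exp\left(-\frac{|x|^2}{Ct}\right)&\text{if }|x|\le t,\\[4pt]\exp\left(-\frac{|x|}{C}\right)&\text{if }|x|>t.\end{cases}$$
   Context: Let $|\cdot|$ be the Euclidean norm on $\mathbb{Z}^d$ and let $\mathbb{B}$ be the set of unoriented nearest-neighbour edges $\{y,z\}$, $y,z\in\mathbb{Z}^d$, $|y-z|=1$. Let $\Omega:=\{(x,\eta)\in\mathbb{Z}^d\times\{0,1\}^{\mathbb{Z}^d}:\eta(x)=1\}$. For $e\in\mathbb{B}$ and $x\in\mathbb{Z}^d$, $x^e:=y$ if $e=\{x,y\}$ and $x^e:=x$ if $x\notin e$; $\eta^e(z):=\eta(z^e)$; and for $f:\Omega\to\mathbb{R}$, $f^e(x,\eta):=f(x^e,\eta^e)$. Put $a_e(\eta):=1$ if $\eta^e\ne\eta$ and $a_e(\eta):=0$ otherwise. The symmetric simple exclusion process with a tagged particle is the Markov process $(\mathbf{X}_t,\boldsymbol{\eta}_t)_{t\ge0}$ on $\Omega$ with generator (formally) $\mathcal{L}f=\sum_{e\in\mathbb{B}}a_e(f^e-f)$; $\mathbf{P}_{(x,\eta)}$ denotes its law started from $(x,\eta)\in\Omega$. For $x\in\mathbb{Z}^d$, $\langle\,\cdot\,|\,X=x\rangle_\rho$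 denotes the expectation (probability measure) on $(X,\eta)\in\Omega$ under which $X=x$ almost surely (so $\eta(x)=1$) and $(\eta(y))_{y\ne x}$ are independent Bernoulli random variables with parameter $\rho$. The expectation $\langle\cdot\rangle$ averages over the initial condition $(X,\eta)$. *)

(* Defs.v *)
From HB Require Import structures.
From mathcomp Require Import all_boot all_order all_algebra finmap.
From mathcomp Require Import all_classical all_reals all_analysis.

Set Implicit Arguments.
Unset Strict Implicit.
Unset Printing Implicit Defensive.

Import Order.TTheory GRing.Theory Num.Theory.
Import numFieldNormedType.Exports.

Local Open Scope classical_set_scope.
Local Open Scope ring_scope.

Notation site d := 'rV[int]_d.
Notation config d := ('rV[int]_d -> bool).

Definition eucl (R : realType) (d : nat) (x : site d) : R :=
  Num.sqrt (\sum_(i < d) (x ord0 i)%:~R ^+ 2).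

Definition nn_edges (R : realType) (d : nat) : set {fset site d} :=
  [set e | exists y z : site d, eucl R (y - z) = 1 /\ e = [fset y; z]%fset].

Arguments nn_edges R d : clear implicits.

(* x^e: the endpoint of e other than x if x is in e, and x itself otherwise. *)
Definition flip (d : nat) (e : {fset site d}) (x : site d) : site d :=
  xget x [set y | e = [fset x; y]%fset].

Definition flip_config (d : nat) (e : {fset site d}) (eta : config d) :
  config d := fun z => eta (flip e z).

Lemma flipK (d : nat) (e : {fset site d}) : involutive (flip e).
Proof.
move=> x; rewrite {2}/flip; case: xgetP => [y _ /= exy|noy].
  rewrite /flip; apply: xget_unique => [|z /= eyz] /=; first by rewrite fsetUC.
  have : x \in [fset y; z]%fset by rewrite -eyz exy !inE eqxx.
  rewrite !inE => /orP[/eqP xy|/eqP->//].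
  have : z \in [fset x; y]%fset by rewrite -exy eyz !inE eqxx orbT.
  by rewrite !inE xy orbb => /eqP.
by rewrite /flip; case: xgetP => [y _ /noy|].
Qed.

(* The state space Omega: a tagged site together with a configuration that
   is occupied at that site. *)
Definition tagged_config (d : nat) : Type :=
  {p : site d * config d | p.2 p.1}.

HB.instance Definition _ (d : nat) := Choice.copy (tagged_config d)
  {p : site d * config d | p.2 p.1}.
HB.instance Definition _ (d : nat) :=
  isPointed.Build (tagged_config d)
    (exist (fun p : site d * config d => p.2 p.1) (0, fun=> true) isT).

Definition cylinders (d : nat) : set (set (tagged_config d)) :=
  [set A | (exists y : site d, A = [set w : tagged_config d | (sval w).1 = y]) \/
           (exists y : site d, A = [set w : tagged_config d | (sval w).2 y])].

Arguments cylinders d : clear implicits.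

Definition Omega (d : nat) := g_sigma_algebraType (cylinders d).

Definition tag_pos (d : nat) (w : Omega d) : site d := (sval w).1.
Definition occ (d : nat) (w : Omega d) : config d := (sval w).2.

Lemma flip_subproof (d : nat) (e : {fset site d}) (w : Omega d) :
  (flip_config e (occ w)) (flip e (tag_pos w)).
Proof. by rewrite /flip_config flipK; exact: (svalP w). Qed.

Definition flip_state (d : nat) (e : {fset site d}) (w : Omega d) : Omega d :=
  exist (fun p : site d * config d => p.2 p.1)
    (flip e (tag_pos w), flip_config e (occ w)) (flip_subproof e w).

Definition rate (R : realType) (d : nat) (e : {fset site d}) (w : Omega d) : R :=
  if flip_config e (occ w) != occ w then 1 else 0.

(* The formal generator.  The sum over a set of indices is 0 when infinitely
   many terms are nonzero; for the local functions below only the edges that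
   meet the finite set Lambda contribute, so the sum is a genuine one. *)
Definition ssep_gen (R : realType) (d : nat) (f : Omega d -> R) (w : Omega d) : R :=
  \sum_(e \in nn_edges R d) rate R e w * (f (flip_state e w) - f w).

Definition local_fun (R : realType) (d : nat) (f : Omega d -> R) : Prop :=
  exists Lambda : {fset site d},
    (forall w, tag_pos w \notin Lambda -> f w = 0) /\
    (forall w w', tag_pos w = tag_pos w' ->
       (forall y, y \in Lambda -> occ w y = occ w' y) -> f w = f w').

Definition past (R : realType) (dS dW : measure_display)
    (S : measurableType dS) (W : measurableType dW)
    (Y : R -> W -> S) (s : R) : set (set W) :=
  <<s [set B | exists r A, [/\ 0 <= r <= s, measurable A & B = Y r @^-1` A]] >>.

(* A time-homogeneous Markov process with values in S: P a is the law under
   which the process Y starts from a. *)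
Definition markov_process (R : realType) (dS dW : measure_display)
    (S : measurableType dS) (W : measurableType dW)
    (P : R.-pker S ~> W) (Y : R -> W -> S) : Prop :=
  [/\ forall t, 0 <= t -> measurable_fun setT (Y t),
      forall a, P a (Y 0 @^-1` [set a]) = 1%E
    & forall (a : S) (s t : R) (B : set W) (A : set S),
        0 <= s -> 0 <= t -> past Y s B -> measurable A ->
        P a (B `&` Y (s + t) @^-1` A) =
        (\int[P a]_(w in B) P (Y s w) (Y t @^-1` A))%E].

(* (E_w[f(Y_h)] - f(w)) / h --> L f (w) as h --> 0+, uniformly in w, for
   every local f.  The local functions, which vanish unless the tagged site
   lies in a finite set, form a core of the closed generator, so that together
   with the Markov property this determines the law of Y. *)
Definition has_ssep_generator (R : realType) (d : nat) (dW : measure_display)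
    (W : measurableType dW) (P : R.-pker (Omega d) ~> W)
    (Y : R -> W -> Omega d) : Prop :=
  forall f : Omega d -> R, local_fun f ->
  forall eps : R, 0 < eps ->
  \forall h \near 0^'+, forall w : Omega d,
    `| (Rintegral (P w) setT (f \o Y h) - f w) / h - ssep_gen f w | <= eps.

Definition tagged_ssep (R : realType) (d : nat) (dW : measure_display)
    (W : measurableType dW) (P : R.-pker (Omega d) ~> W)
    (Y : R -> W -> Omega d) : Prop :=
  markov_process P Y /\ has_ssep_generator P Y.

(* mu is the law <. | X = x>_rho, described by its finite-dimensional
   marginals. *)
Definition bernoulli_given (R : realType) (d : nat) (rho : R) (x : site d)
    (mu : probability (Omega d) R) : Prop :=
  mu [set w | tag_pos w = x] = 1%E /\
  forall (Lambda : {fset site d}) (sigma : config d), x \notin Lambda ->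
    mu [set w | forall y, y \in Lambda -> occ w y = sigma y] =
    (\prod_(y <- enum_fset Lambda) (if sigma y then rho else 1 - rho))%:E.

(* Main.v *)
Require Import Defs.
From mathcomp Require Import all_boot all_order all_algebra finmap.
From mathcomp Require Import all_classical all_reals all_analysis.
From mathcomp Require Import measurable_realfun ring lra zify.

Import Order.TTheory GRing.Theory Num.Theory.
Local Open Scope classical_set_scope.
Local Open Scope ring_scope.

Set Implicit Arguments.
Unset Strict Implicit.
Unset Printing Implicit Defensive.

(** The bound is a Chernoff bound in L2.  Give the state space the measure
    under which the tagged site is counted and the other sites are independent
    Bernoulli variables.  Every exchange across an edge preserves this measure,
    so the generator is symmetric.  Tilt it with the weight
    phi y = exp (- s (x . y)).  Along an exchange that moves the tagged site
    from y to z, the first-order terms in s cancel by symmetry and what is left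
    is the factor (phi y / phi z + phi z / phi y) / 2 <= 1 + 2 (s |x|)^2.  Hence
    the phi-weighted L2 norm of the function u_t w = P_w [X_t = x] grows at most
    at rate 2 D (s |x|)^2, with D the number of unit vectors
    ([dirichlet_form], [energy_euler]).  At time 0 this norm is
    phi x = exp (- s |x|^2), and since phi 0 = 1 it dominates the average of
    u_t over the configurations with tagged site 0, a set of mass one
    ([Rintegral_mu_le_energy]).  Therefore

      < P [X_t = x] | X = 0 > <= exp (2 D s^2 |x|^2 t - s |x|^2)

    whenever s |x| <= 1 ([chernoff_bound]).  Taking s of order 1 / t if
    |x| <= t and of order 1 / |x| otherwise gives the two regimes, with no
    prefactor to absorb.

    To make this rigorous for an infinite system, u_t is replaced by the
    explicit Euler scheme of the system in which only the edges of a finite box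
    move ([euler_iter]).  Its iterates are local functions, so all sums are
    finite and the derivative of the process at time 0 is known on them,
    uniformly because the local functions on a box form a finite-dimensional
    space ([generator_step]).  The Markov property adds up the one-step errors
    ([euler_comparison]).  The one error that is not small with the time step
    comes from the edges at the boundary of the box.  It is controlled by the
    finite speed of propagation: exchanges across disjoint edges commute, so the
    dependence of an iterate on an exchange spreads only between touching
    edges, and its sum with a weight that doubles with the distance stays
    bounded uniformly in the box and in the time step ([total_influence_le],
    [box_gen_boundary]). *)

(** * Exchanges across an edge *)

Section exchange.
Variable d : nat.
Implicit Types (e b : {fset site d}) (x y z : site d) (w : Omega d).

Lemma flip_out e y : y \notin e -> flip e y = y.
Proof.
move=> ye; rewrite /flip; case: xgetP => // z _ /= eE.
by move: ye; rewrite eE !inE eqxx.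
Qed.

Lemma flip_pair e y : flip e y != y -> e = [fset y; flip e y]%fset.
Proof. by rewrite /flip; case: xgetP => [z _ //|_]; rewrite eqxx. Qed.

Lemma flip_in e y : (flip e y \in e) = (y \in e).
Proof.
have H z : z \in e -> flip e z \in e.
  move=> ze; case: (eqVneq (flip e z) z) => [->//|/flip_pair eE].
  by rewrite {2}eE !inE eqxx orbT.
by apply/idP/idP => [/H|/H//]; rewrite flipK.
Qed.

Lemma flip_edge y z : flip [fset y; z]%fset y = z.
Proof.
rewrite /flip; apply: xget_unique => //= u eE.
have : u \in [fset y; z]%fset by rewrite eE !inE eqxx orbT.
have : z \in [fset y; u]%fset by rewrite -eE !inE eqxx orbT.
by rewrite !inE => /orP[/eqP zy|/eqP->//] /orP[/eqP->|/eqP//].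
Qed.

Lemma flip_stable e (L : {fset site d}) y :
  (e `<=` L)%fset -> (flip e y \in L) = (y \in L).
Proof.
move=> /fsubsetP eL; have [ye|ye] := boolP (y \in e); last by rewrite flip_out.
by rewrite !eL // flip_in.
Qed.

Lemma flipC e b y : [disjoint e & b]%fset -> flip e (flip b y) = flip b (flip e y).
Proof.
move=> /fdisjointP eb; have [ye|ye] := boolP (y \in e).
  by rewrite (@flip_out b y) ?eb// (@flip_out b) // eb // flip_in.
rewrite (@flip_out e y)//; have [yb|yb] := boolP (y \in b); last first.
  by rewrite (@flip_out b)// flip_out.
by rewrite flip_out //; apply/negP => /eb; rewrite flip_in yb.
Qed.

Definition active e w : bool := flip_config e (occ w) != occ w.

(** The identity where the rate vanishes, so that exch e is an involution of
    the whole state space and the generator is the sum over e of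
    g o exch e - g. *)
Definition exch e w : Omega d := if active e w then flip_state e w else w.

Lemma Omega_eq w w' : tag_pos w = tag_pos w' -> occ w =1 occ w' -> w = w'.
Proof.
case: w w' => [[y s] p] [[y' s'] p'] /= yy' /funext ss'; apply: eq_exist => /=.
by rewrite (_ : y = y') // (_ : s = s').
Qed.

Lemma occ_exch e w : occ (exch e w) = flip_config e (occ w).
Proof. by rewrite /exch; case: ifPn => // /negPn/eqP. Qed.

Lemma tag_exch e w :
  tag_pos (exch e w) = if active e w then flip e (tag_pos w) else tag_pos w.
Proof. by rewrite /exch; case: ifPn. Qed.

Lemma flip_configK e : involutive (@flip_config d e).
Proof. by move=> s; apply/funext => y; rewrite /flip_config flipK. Qed.

Lemma active_exch e w : active e (exch e w) = active e w.
Proof.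
by rewrite /active occ_exch flip_configK eq_sym.
Qed.

Lemma exchK e : involutive (exch e).
Proof.
move=> w; apply: Omega_eq => [|y]; last by rewrite !occ_exch flip_configK.
by rewrite !tag_exch active_exch; case: (active e w); rewrite ?flipK.
Qed.

(** The swap across b commutes with the swap across e and is injective on
    configurations, so it cannot create or destroy a difference between a
    configuration and its image under the swap across e. *)
Lemma active_exch_disjoint e b w :
  [disjoint e & b]%fset -> active e (exch b w) = active e w.
Proof.
move=> eb; rewrite /active occ_exch; congr negb.
have -> : flip_config e (flip_config b (occ w)) =
          flip_config b (flip_config e (occ w)).
  by apply/funext => y; rewrite /flip_config flipC // fdisjoint_sym.
by apply/eqP/eqP => [/(congr1 (flip_config b))|->//]; rewrite !flip_configK.
Qed.

(** The source of the finite speed of propagation: only touching edges interact,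
    even though the tagged particle makes the rates configuration dependent. *)
Lemma exchC e b w : [disjoint e & b]%fset -> exch e (exch b w) = exch b (exch e w).
Proof.
move=> eb; have be : [disjoint b & e]%fset by rewrite fdisjoint_sym.
apply: Omega_eq => [|y]; last first.
  by rewrite !occ_exch /flip_config flipC.
rewrite !tag_exch !active_exch_disjoint //.
by case: (active e w); case: (active b w) => //; rewrite flipC.
Qed.

Lemma tag_exch_out e w : tag_pos w \notin e -> tag_pos (exch e w) = tag_pos w.
Proof. by move=> we; rewrite tag_exch flip_out // if_same. Qed.

Lemma tag_exch_stable e (L : {fset site d}) w :
  (e `<=` L)%fset -> (tag_pos (exch e w) \in L) = (tag_pos w \in L).
Proof. by move=> eL; rewrite tag_exch; case: ifP => _ //; rewrite flip_stable. Qed.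

Definition agree (L : {fset site d}) w w' :=
  tag_pos w = tag_pos w' /\ (forall y, y \in L -> occ w y = occ w' y).

Lemma agree_active e (L : {fset site d}) w w' :
  (e `<=` L)%fset -> agree L w w' -> active e w = active e w'.
Proof.
have H v v' : (e `<=` L)%fset -> agree L v v' -> active e v -> active e v'.
  move=> eL [_ vv']; apply: contraNN => /eqP av'; apply/eqP/funext => y.
  have [ye|ye] := boolP (y \in e); last by rewrite /flip_config flip_out.
  rewrite /flip_config !vv' ?(fsubsetP eL) ?flip_in//.
  by rewrite -[in RHS]av'.
move=> eL [ww' oo']; apply/idP/idP; apply: H => //; split=> // y yL.
by rewrite oo'.
Qed.

Lemma agree_exch e (L : {fset site d}) w w' :
  (e `<=` L)%fset -> agree L w w' -> agree L (exch e w) (exch e w').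
Proof.
move=> eL ww'; rewrite /agree !tag_exch !(agree_active eL ww'); split.
  by rewrite ww'.1.
by move=> y yL; rewrite !occ_exch /flip_config ww'.2 // flip_stable.
Qed.

End exchange.

(** * Functions of the tagged site and configuration in a finite set *)
Section local_on.
Variables (R : realType) (d : nat).
Implicit Types (e b : {fset site d}) (L : {fset site d}) (g : Omega d -> R).

(** Requiring g to vanish when the tagged site is outside L makes these
    functions a finite-dimensional space that exchanges inside L preserve. *)
Definition local_on L g :=
  (forall w, tag_pos w \notin L -> g w = 0) /\
  (forall w w', agree L w w' -> g w = g w').

Lemma local_on_local_fun L g : local_on L g -> local_fun g.
Proof. by move=> [g0 gL]; exists L; split=> // w w' t o; apply: gL. Qed.

Lemma local_on_exch L e g : (e `<=` L)%fset -> local_on L g ->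
  local_on L (g \o exch e).
Proof.
move=> eL [g0 gL]; split=> [w wL|w w' ww'] /=; last by apply/gL/agree_exch.
by apply: g0; rewrite tag_exch_stable.
Qed.

(** An exchange away from L can neither bring the tagged site into L nor take
    it out of L. *)
Lemma local_on_disjoint L e g w : [disjoint e & L]%fset -> local_on L g ->
  g (exch e w) = g w.
Proof.
move=> /fdisjointP eL [g0 gL].
have [wL|wL] := boolP (tag_pos w \in L).
  apply: gL; split.
    by rewrite tag_exch_out//; apply/negP => /eL; rewrite wL.
  move=> y yL; rewrite occ_exch /flip_config flip_out //.
  by apply/negP => /eL; rewrite yL.
rewrite [RHS]g0// g0// tag_exch; case: ifP => // _.
have [te|te] := boolP (tag_pos w \in e); last by rewrite flip_out.
by apply: eL; rewrite flip_in.
Qed.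

Lemma rate_exch e w g :
  rate R e w * (g (flip_state e w) - g w) = g (exch e w) - g w.
Proof.
rewrite /rate /exch /active; case: ifP => _; first by rewrite mul1r.
by rewrite mul0r subrr.
Qed.

End local_on.

(** * Boxes, edges and degrees in the lattice *)
Section lattice.
Variables (R : realType) (d : nat).
Implicit Types (e b : {fset site d}) (x y z v : site d).

Definition supnorm y : nat := \max_(i < d) `|y ord0 i|%N.

Lemma finite_supnorm n : finite_set [set y : site d | (supnorm y <= n)%N].
Proof.
pose F (f : {ffun 'I_d -> 'I_(n.*2.+1)}) : site d :=
  \row_i ((f i : nat)%:Z - n%:Z).
apply: (@sub_finite_set _ _ (F @` setT)); last exact/finite_image/finite_finset.
move=> y /= yn; exists [ffun i => inord (absz (y ord0 i + n%:Z))] => //.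
apply/rowP => i; rewrite mxE ffunE.
have : (`|y ord0 i| <= n)%N by apply: leq_trans yn; rewrite /supnorm; apply: leq_bigmax.
by move: (y ord0 i) => u un; rewrite inordK; lia.
Qed.

Definition box n : {fset site d} := fset_set [set y | (supnorm y <= n)%N].

Lemma in_box n y : (y \in box n) = (supnorm y <= n)%N.
Proof.
rewrite /box in_fset_set; last exact: finite_supnorm.
by apply/idP/idP; rewrite inE.
Qed.

Lemma supnormD y z : (supnorm (y + z) <= supnorm y + supnorm z)%N.
Proof.
apply/bigmax_leqP => i _; rewrite mxE.
have : (`|y ord0 i| <= supnorm y)%N by apply: leq_bigmax.
have : (`|z ord0 i| <= supnorm z)%N by apply: leq_bigmax.
by move: (y ord0 i) (z ord0 i) (supnorm y) (supnorm z) => u v m n; lia.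
Qed.

Lemma supnorm0 : supnorm 0 = 0%N.
Proof. by apply/eqP; rewrite -leqn0; apply/bigmax_leqP => i _; rewrite mxE. Qed.

Lemma euclN y : eucl R (- y) = eucl R y.
Proof.
by congr Num.sqrt; apply: eq_bigr => i _; rewrite mxE rmorphN sqrrN.
Qed.

Lemma sqr_eucl y : eucl R y ^+ 2 = \sum_(i < d) (y ord0 i)%:~R ^+ 2.
Proof. by rewrite sqr_sqrtr // sumr_ge0 // => i _; rewrite sqr_ge0. Qed.

Lemma eucl_ge0 y : 0 <= eucl R y.
Proof. exact: sqrtr_ge0. Qed.

Lemma eucl1_supnorm v : eucl R v = 1 -> (supnorm v <= 1)%N.
Proof.
move=> v1; apply/bigmax_leqP => i _.
have : ((v ord0 i)%:~R : R) ^+ 2 <= eucl R v ^+ 2.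
  rewrite sqr_eucl (bigD1 i) //= lerDl.
  by rewrite sumr_ge0 // => j _; rewrite sqr_ge0.
rewrite v1 expr1n.
rewrite -rmorphXn /= -[leRHS]/(1%:~R) ler_int => h.
have {h} : ((v ord0 i) * (v ord0 i) <= 1)%R by rewrite -expr2.
by move: (v ord0 i) => u; nia.
Qed.

Definition unit_vectors : {fset site d} := [fset v in box 1 | eucl R v == 1]%fset.

Lemma in_unit_vectors v : (v \in unit_vectors) = (eucl R v == 1).
Proof.
rewrite !inE /= in_box; apply/andP/idP => [[]//|v1]; split => //.
by apply/eucl1_supnorm/eqP.
Qed.

Lemma nn_edge_at e z : nn_edges R d e -> z \in e ->
  exists2 v, v \in unit_vectors & e = [fset z; (z + v)%R]%fset.
Proof.
move=> [a [b [ab ->]]]; rewrite !inE => /orP[]/eqP->.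
  exists (b - a); last by rewrite addrC subrK.
  by rewrite in_unit_vectors -euclN opprB ab.
exists (a - b); last by rewrite addrC subrK fsetUC.
by rewrite in_unit_vectors ab.
Qed.

Lemma flip_nn_edge e z : nn_edges R d e -> z \in e -> flip e z - z \in unit_vectors.
Proof.
by move=> ne /(nn_edge_at ne)[v vu ->]; rewrite flip_edge addrC addKr.
Qed.

Definition degree : nat := #|` unit_vectors|.

Lemma count_edges_at (S : {fset {fset site d}}) z :
  (forall e, e \in S -> nn_edges R d e) ->
  (count (fun e => z \in e) S <= degree)%N.
Proof.
move=> nS; rewrite -size_filter.
rewrite /degree -(size_map (fun v => [fset z; (z + v)%R]%fset)).
apply: uniq_leq_size; first by rewrite filter_uniq // fset_uniq.
move=> e; rewrite mem_filter => /andP[ze eS].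
have [v vu ->] := nn_edge_at (nS _ eS) ze.
by apply/mapP; exists v.
Qed.

(** The form in which the finite degree of the lattice enters both the energy
    and the propagation estimates. *)
Lemma sum_edges_at (S : {fset {fset site d}}) z (F : {fset site d} -> R) c :
  (forall e, e \in S -> nn_edges R d e) -> 0 <= c ->
  (forall e, e \in S -> z \in e -> F e <= c) ->
  \sum_(e <- S | z \in e) F e <= degree%:R * c.
Proof.
move=> nS c0 Fc; rewrite big_seq_cond.
apply: (@le_trans _ _ (\sum_(e <- S | (e \in S) && (z \in e)) c)).
  by apply: ler_sum => e /andP[]; apply: Fc.
rewrite -big_seq_cond big_const_seq iter_addr_0 [leRHS]mulr_natl.
by rewrite ler_wpMn2l // count_edges_at.
Qed.

Definition edges n : {fset {fset site d}} :=
  [fset e in fpowerset (box n) | `[< nn_edges R d e >]]%fset.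

Lemma edgesP n e :
  reflect (nn_edges R d e /\ (e `<=` box n)%fset) (e \in edges n).
Proof.
rewrite !inE /= fpowersetE; apply: (iffP andP) => [[ea /asboolP]//|[ne ea]].
by split=> //; apply/asboolP.
Qed.

Lemma edges_nn n e : e \in edges n -> nn_edges R d e.
Proof. by case/edgesP. Qed.

Lemma edges_sub n e : e \in edges n -> (e `<=` box n)%fset.
Proof. by case/edgesP. Qed.

Lemma nn_edge_supnorm e y z : nn_edges R d e -> y \in e -> z \in e ->
  (supnorm z <= (supnorm y).+1)%N.
Proof.
move=> ne ye; have [v vu ->] := nn_edge_at ne ye.
rewrite !inE => /orP[]/eqP-> //; apply: leq_trans (supnormD _ _) _.
by rewrite -addn1 leq_add2l eucl1_supnorm //; apply/eqP; rewrite -in_unit_vectors.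
Qed.

(** One extra layer suffices: functions that live on box n see no edge beyond
    box n.+1. *)
Lemma edges_meet n e : nn_edges R d e -> ~~ [disjoint e & box n]%fset ->
  e \in edges n.+1.
Proof.
move=> ne /fdisjointP h; apply/edgesP; split=> //.
apply/fsubsetP => y ye; rewrite in_box.
have [z ze zb] : exists2 z, z \in e & z \in box n.
  by apply/not_exists2P => h'; apply: h => z ze; apply/negP => zb; case: (h' z).
by apply: leq_trans (nn_edge_supnorm ne ze ye) _; rewrite ltnS -in_box.
Qed.

Definition edge_norm e : nat := \max_(y <- e) supnorm y.

Lemma edge_norm_touch e b z : nn_edges R d b -> z \in e -> z \in b ->
  (edge_norm b <= (edge_norm e).+1)%N.
Proof.
move=> nb ze zb; rewrite /edge_norm; apply/bigmax_leqP_seq => y yb _.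
apply: leq_trans (nn_edge_supnorm nb zb yb) _; rewrite ltnS.
by apply: (@leq_bigmax_seq _ _ xpredT supnorm z).
Qed.

Lemma edge_norm_at e z : nn_edges R d e -> z \in e -> (edge_norm e <= (supnorm z).+1)%N.
Proof.
by move=> ne ze; apply/bigmax_leqP_seq => y yb _; apply: nn_edge_supnorm ne ze yb.
Qed.

Lemma edge_norm_out n e : ~~ (e `<=` box n)%fset -> (n.+1 <= edge_norm e)%N.
Proof.
move=> /fsubsetPn[y ye]; rewrite in_box -ltnNge => /leq_trans; apply.
by apply: (@leq_bigmax_seq _ _ xpredT supnorm y).
Qed.

End lattice.

(** * Euler scheme in a box and finite speed of propagation *)
Section euler.
Variables (R : realType) (d : nat).
Implicit Types (e b : {fset site d}) (x y z : site d) (g : Omega d -> R).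

Lemma subset_edges n : (edges R d n `<=` edges R d n.+1)%fset.
Proof.
apply/fsubsetP => e /edgesP[ne eb]; apply/edgesP; split=> //.
apply: fsubset_trans eb _; apply/fsubsetP => y; rewrite !in_box.
by move=> /leqW.
Qed.

Lemma sum_edgesS n (F : {fset site d} -> R) :
  \sum_(e <- edges R d n.+1) F e =
  \sum_(e <- edges R d n) F e +
  \sum_(e <- edges R d n.+1 | e \notin edges R d n) F e.
Proof.
rewrite (bigID (mem (edges R d n)))/=; congr (_ + _).
rewrite big_mkcond -(big_fset_incl _ (subset_edges n)) /=.
  by apply: eq_big_seq => e ->.
by move=> e _ /negPf ->.
Qed.

Definition box_gen n g (w : Omega d) : R :=
  \sum_(e <- edges R d n) (g (exch e w) - g w).

(** Explicit Euler steps stand in for the semigroup of the system in the box: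
    each step is an algebraic expression, with no differential equation in time
    to solve. *)
Definition euler n (h : R) g (w : Omega d) : R := g w + h * box_gen n g w.

(** On a local function the full generator is a finite sum, over one layer of
    edges more than the box in which the Euler scheme moves. *)
Lemma ssep_gen_local n g w : local_on (box d n) g ->
  ssep_gen g w = box_gen n.+1 g w.
Proof.
move=> gl; rewrite /ssep_gen /box_gen.
under eq_fsbigr do rewrite rate_exch.
rewrite [RHS]fsbig_seq ?fset_uniq//; apply/esym/fsbig_widen.
  by move=> e /= /edges_nn.
move=> e [/= ne eE]; rewrite (local_on_disjoint _ _ gl) ?subrr//.
by apply/negPn/negP => /(edges_meet ne).
Qed.

Lemma local_on_euler n h g : local_on (box d n) g -> local_on (box d n) (euler n h g).
Proof.
move=> gl; have [g0 gL] := gl; split=> [w wL|w w' ww']; rewrite /euler /box_gen.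
  rewrite g0 // add0r big_seq big1 ?mulr0// => e /edges_sub eb.
  by rewrite !g0 ?subrr // tag_exch_stable.
congr (_ + _ * _); first exact: gL.
apply: eq_big_seq => e /edges_sub eb; congr (_ - _); last exact: gL.
exact: (local_on_exch eb gl).2.
Qed.

Definition nedges n : R := (size (edges R d n))%:R.

Lemma nedges_ge0 n : 0 <= nedges n.
Proof. exact: ler0n. Qed.

Lemma eulerE n h g w : euler n h g w =
  (1 - h * nedges n) * g w + h * \sum_(e <- edges R d n) g (exch e w).
Proof.
rewrite /euler /box_gen big_split /= sumrN big_const_seq iter_addr_0 count_predT.
by rewrite /nedges -mulr_natl; ring.
Qed.

(** For h times the number of edges at most 1, an Euler step averages g over
    the state and its exchanges. *)
Lemma euler_range n h g : 0 <= h -> h * nedges n <= 1 ->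
  (forall w, 0 <= g w <= 1) -> forall w, 0 <= euler n h g w <= 1.
Proof.
move=> h0 h1 gr w; rewrite eulerE.
have gw := gr w.
have s0 : 0 <= \sum_(e <- edges R d n) g (exch e w).
  by apply: sumr_ge0 => e _; case/andP: (gr (exch e w)).
have s1 : \sum_(e <- edges R d n) g (exch e w) <= nedges n.
  rewrite /nedges -sum1_size natr_sum; apply: ler_sum => e _.
  by case/andP: (gr (exch e w)).
have := ler_wpM2l h0 s1; have := mulr_ge0 h0 s0.
have : 0 <= (1 - h * nedges n) * g w by rewrite mulr_ge0 ?subr_ge0; case/andP: gw.
have : (1 - h * nedges n) * g w <= (1 - h * nedges n) * 1.
  by rewrite ler_wpM2l ?subr_ge0; case/andP: gw.
by move=> *; apply/andP; split; lra.
Qed.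

Definition tag_indic x (w : Omega d) : R := (tag_pos w == x)%:R.

Definition euler_iter n h x k := iter k (euler n h) (tag_indic x).

Lemma local_on_euler_iter n h x k : x \in box d n ->
  local_on (box d n) (euler_iter n h x k).
Proof.
move=> xb; elim: k => [|k IH]; last exact: local_on_euler.
rewrite /euler_iter /= /tag_indic; split=> [w|w w' [-> //]].
by have [->|//] := eqVneq (tag_pos w) x; rewrite xb.
Qed.

Lemma euler_iter_range n h x k : 0 <= h -> h * nedges n <= 1 ->
  forall w, 0 <= euler_iter n h x k w <= 1.
Proof.
move=> h0 h1; elim: k => [|k IH]; last exact: euler_range.
by move=> w; rewrite /euler_iter /= /tag_indic ler0n lern1 leq_b1.
Qed.

(** How much the k-th iterate may change under an exchange across b; in each
    step this dependence moves by at most one layer of touching edges. *)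
Fixpoint influence n (h : R) x k b : R :=
  if k is k'.+1 then influence n h x k' b +
     2 * h * \sum_(e <- edges R d n | ~~ [disjoint e & b]%fset) influence n h x k' e
  else (x \in b)%:R.

Lemma influence_ge0 n h x k b : 0 <= h -> 0 <= influence n h x k b.
Proof.
move=> h0; elim: k b => [|k IH] b /=; first by rewrite ler0n.
by rewrite addr_ge0 // !mulr_ge0 // sumr_ge0.
Qed.

(** A one-sided bound is enough, because exch b is an involution.  In the
    recursion an edge disjoint from b commutes with it and only averages earlier
    differences; an edge e that touches b adds at most twice its own
    influence. *)
Lemma euler_iter_exch_le n h x k b w : 0 <= h -> h * nedges n <= 1 ->
  euler_iter n h x k (exch b w) - euler_iter n h x k w <= influence n h x k b.
Proof.
move=> h0 h1; elim: k b w => [|k IH] b w /=.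
  rewrite /euler_iter /= /tag_indic.
  have [xb|xb] := boolP (x \in b).
    by move: (_ == x) (tag_pos w == x) => [] []; rewrite /=; lra.
  rewrite tag_exch; case: (active b w); last by rewrite subrr.
  have [tb|tb] := boolP (tag_pos w \in b); last by rewrite flip_out // subrr.
  have -> : (flip b (tag_pos w) == x) = false.
    by apply/eqP => fx; move: xb; rewrite -fx flip_in tb.
  by rewrite sub0r oppr_le0 ler0n.
rewrite -/(euler_iter n h x k); set g := euler_iter n h x k in IH *.
set U := influence n h x k in IH *.
have U0 e : 0 <= U e by exact: influence_ge0.
set Dl := g (exch b w) - g w.
have DlU : Dl <= U b := IH b w.
suff : box_gen n g (exch b w) - box_gen n g w <=
       nedges n * (U b - Dl) +
       2 * \sum_(e <- edges R d n | ~~ [disjoint e & b]%fset) U e.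
  move=> /(ler_wpM2l h0) H; rewrite /euler.
  have : h * nedges n * (U b - Dl) <= 1 * (U b - Dl).
    by rewrite ler_wpM2r // subr_ge0.
  by move: H; rewrite /Dl; lra.
rewrite /box_gen -sumrB /nedges -sum1_size natr_sum mulr_suml.
rewrite [X in 2 * X]big_mkcond mulr_sumr -big_split /=.
apply: ler_sum => e _; rewrite mul1r.
case: ifPn => [eb|/negPn eb].
  have := IH e (exch b w); have := IH e (exch e w); rewrite exchK => *.
  by have := U0 e; rewrite /Dl in DlU *; lra.
have := IH b (exch e w); rewrite -exchC // /Dl => {}IH.
by rewrite mulr0 addr0; lra.
Qed.

Lemma sum_edges_touching n e (F : {fset site d} -> R) c : nn_edges R d e -> 0 <= c ->
  (forall b, 0 <= F b) ->
  (forall b, b \in edges R d n -> ~~ [disjoint e & b]%fset -> F b <= c) ->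
  \sum_(b <- edges R d n | ~~ [disjoint e & b]%fset) F b <= 2 * (degree R d)%:R * c.
Proof.
move=> [y [z [_ eE]]] c0 F0 Fc.
have touchP b : ~~ [disjoint e & b]%fset = (y \in b) || (z \in b).
  rewrite eE; apply/negP/idP => [h|].
    apply/negPn/negP; rewrite negb_or => /andP[yb zb]; apply: h.
    by apply/fdisjointP => u; rewrite !inE => /orP[]/eqP->.
  by move=> h /fdisjointP dj; move/orP: h => []; apply/negP/dj; rewrite !inE eqxx ?orbT.
have Hat u : u \in e ->
    \sum_(b <- edges R d n | u \in b) F b <= (degree R d)%:R * c.
  move=> ue; apply: sum_edges_at => // b; first exact: edges_nn.
  move=> bE ub; apply: Fc => //; apply/negP => /fdisjointP/(_ _ ue).
  by rewrite ub.
have := Hat y; have := Hat z; rewrite eE !inE !eqxx orbT => /(_ isT) hz /(_ isT) hy.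
apply: (@le_trans _ _ (\sum_(b <- edges R d n | y \in b) F b +
                       \sum_(b <- edges R d n | z \in b) F b)); last by lra.
rewrite big_mkcond [X in _ <= X + _]big_mkcond [X in _ <= _ + X]big_mkcond.
rewrite -big_split; apply: ler_sum => b _; rewrite -eE touchP /=.
by case: (y \in b); case: (z \in b); rewrite /= ?addr0 ?add0r // lerDl.
Qed.

(** Doubling with the distance from the origin: fast enough to make the boundary
    of a large box negligible, and slow enough for touching edges to have
    comparable weights, so that the weighted total grows at a rate that does
    not depend on the box. *)
Definition edge_weight b : R := 2 ^+ edge_norm b.

Lemma edge_weight_gt0 b : 0 < edge_weight b. Proof. exact: exprn_gt0. Qed.

Definition total_influence n h x k :=
  \sum_(b <- edges R d n.+1) edge_weight b * influence n h x k b.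

(** After exchanging the two sums, each edge e passes its influence on to at
    most 2 degree touching edges, of weight at most twice its own. *)
Lemma total_influenceS n h x k : 0 <= h ->
  total_influence n h x k.+1 <=
  (1 + 8 * (degree R d)%:R * h) * total_influence n h x k.
Proof.
move=> h0; rewrite /total_influence mulrDl mul1r /=.
under eq_bigr do rewrite mulrDr mulrCA.
rewrite big_split /= lerD2l -mulr_sumr.
set D := (degree R d)%:R; set U := influence n h x k.
have U0 e : 0 <= U e by exact: influence_ge0.
suff : \sum_(b <- edges R d n.+1)
     edge_weight b * (\sum_(e <- edges R d n | ~~ [disjoint e & b]%fset) U e) <=
   4 * D * \sum_(b <- edges R d n.+1) edge_weight b * U b.
  by move=> /(ler_wpM2l h0); lra.
under eq_bigr do rewrite mulr_sumr.
rewrite (exchange_big_dep xpredT) //=.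
under eq_bigr do rewrite -mulr_suml.
rewrite [X in _ <= _ * X]sum_edgesS mulrDr -[leLHS]addr0; apply: lerD; last first.
  rewrite !mulr_ge0 // ?ler0n // sumr_ge0 // => e _.
  by rewrite mulr_ge0 // ltW // edge_weight_gt0.
rewrite mulr_sumr big_seq [leRHS]big_seq; apply: ler_sum => e eE.
rewrite mulrA ler_wpM2r // -/D.
have -> : 4 * D * edge_weight e = 2 * D * (2 * edge_weight e) by ring.
apply: sum_edges_touching; first exact: edges_nn eE.
- by rewrite mulr_ge0 // ltW // edge_weight_gt0.
- by move=> b; rewrite ltW // edge_weight_gt0.
move=> b bE /fdisjointP eb; rewrite /edge_weight -exprS ler_weXn2l // ?ler1n//.
have [z ze zb] : exists2 z, z \in e & z \in b.
  by apply/not_exists2P => h'; apply: eb => z ze; apply/negP => zb; case: (h' z).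
exact: edge_norm_touch (edges_nn bE) ze zb.
Qed.

Lemma total_influence0 n h x :
  total_influence n h x 0 <= (degree R d)%:R * 2 ^+ (supnorm x).+1.
Proof.
rewrite /total_influence /=.
have -> : \sum_(b <- edges R d n.+1) edge_weight b * (x \in b)%:R =
          \sum_(b <- edges R d n.+1 | x \in b) edge_weight b.
  by rewrite [RHS]big_mkcond; apply: eq_bigr => b _; case: ifP; rewrite ?mulr1 ?mulr0.
apply: sum_edges_at => [b|//|b bE xb]; first exact: edges_nn.
rewrite ler_weXn2l ?ler1n //; exact: edge_norm_at (edges_nn bE) xb.
Qed.

Lemma total_influence_le n h x k : 0 <= h ->
  total_influence n h x k <=
  expR (8 * (degree R d)%:R * (h * k%:R)) * ((degree R d)%:R * 2 ^+ (supnorm x).+1).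
Proof.
move=> h0; set D := (degree R d)%:R.
have D0 : 0 <= D by exact: ler0n.
elim: k => [|k IH].
  by rewrite !mulr0 expR0 mul1r total_influence0.
apply: le_trans (total_influenceS _ _ _ h0) _.
have -> : 8 * D * (h * k.+1%:R) = 8 * D * h + 8 * D * (h * k%:R).
  by rewrite -natr1; ring.
rewrite expRD -[leRHS]mulrA -/D; apply: le_trans (ler_wpM2l _ IH) _.
  by rewrite addr_ge0 // !mulr_ge0.
rewrite ler_wpM2r ?expR_ge1Dx//.
by rewrite !mulr_ge0 // ?expR_ge0 // exprn_ge0.
Qed.

(** An edge of box n.+1 that leaves box n has weight at least 2 ^ n.+1, so its
    share of the total influence is exponentially small. *)
Lemma box_gen_boundary n h x k w : 0 <= h -> h * nedges n <= 1 ->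
  box_gen n.+1 (euler_iter n h x k) w <= box_gen n (euler_iter n h x k) w +
  total_influence n h x k / 2 ^+ n.+1.
Proof.
move=> h0 h1; rewrite /box_gen sum_edgesS lerD2l.
have U0 e : 0 <= influence n h x k e by exact: influence_ge0.
rewrite ler_pdivlMr ?exprn_gt0 // /total_influence sum_edgesS mulr_suml.
rewrite -[leLHS]add0r lerD //.
  by apply: sumr_ge0 => e _; rewrite mulr_ge0 // ltW // edge_weight_gt0.
rewrite big_seq_cond [leRHS]big_seq_cond; apply: ler_sum => e /andP[eE eN].
apply: (@le_trans _ _ (influence n h x k e * 2 ^+ n.+1)).
  by rewrite ler_wpM2r ?exprn_ge0 // euler_iter_exch_le.
rewrite mulrC ler_wpM2r // ler_weXn2l ?ler1n // edge_norm_out //.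
by apply: contra eN => eb; apply/edgesP; split => //; apply: edges_nn eE.
Qed.

End euler.

(** * Finitely many states and the integration of local functions *)
Section finite_states.
Variables (d : nat).
Implicit Types (L : {fset site d}) (w v a : Omega d).

Lemma restrict_subproof L w :
  occ w (tag_pos w) && ((tag_pos w \in L) || (tag_pos w == tag_pos w)).
Proof. by rewrite eqxx orbT andbT; exact: (svalP w). Qed.

(** The tagged site stays occupied even when it lies outside L, so that the
    restriction is defined for every state. *)
Definition restrict_state L w : Omega d :=
  exist (fun p : site d * config d => p.2 p.1)
    (tag_pos w, fun y => occ w y && ((y \in L) || (y == tag_pos w)))
    (restrict_subproof L w).

Lemma agree_restrict L w : agree L (restrict_state L w) w.
Proof. by split=> // y yL; rewrite /occ /= yL andbT. Qed.

(** Representatives of the classes of [agree L] that have the tagged site in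
    L. *)
Definition state_set L : set (Omega d) :=
  [set w | tag_pos w \in L /\ forall y, occ w y -> y \in L].

Lemma finite_states L : finite_set (state_set L).
Proof.
(* A state that is empty outside L is determined by its tagged site and by the
   set of its occupied sites. *)
have mkP (p : site d * {fset site d}) : (p.1 \in p.2) || (p.1 == p.1).
  by rewrite eqxx orbT.
pose mk p : Omega d := exist (fun p : site d * config d => p.2 p.1)
  (p.1, fun y => (y \in p.2) || (y == p.1)) (mkP p).
apply: (@sub_finite_set _ _ (mk @` ([set` L] `*` [set` fpowerset L]))); last first.
  by apply: finite_image; apply: finite_setX; exact: finite_fset.
move=> w [wL oL]; exists (tag_pos w, [fset y in L | occ w y]%fset).
  by split=> //=; rewrite fpowersetE; apply/fsubsetP => y; rewrite !inE => /andP[].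
apply: Omega_eq => // y; rewrite {1}/occ /= !inE /=.
have [->|_] := eqVneq y (tag_pos w).
  by rewrite orbT; apply/esym; exact: (svalP w).
by rewrite orbF; apply/andP/idP => [[]//|wy]; split=> //; exact: oL.
Qed.

Definition states L : {fset Omega d} := fset_set (state_set L).

Lemma statesP L w :
  reflect (tag_pos w \in L /\ forall y, occ w y -> y \in L) (w \in states L).
Proof.
rewrite /states in_fset_set; last exact: finite_states.
by apply: (iffP idP) => [/set_mem|/mem_set].
Qed.

Lemma restrict_states L w : tag_pos w \in L -> restrict_state L w \in states L.
Proof.
move=> wL; apply/statesP; split=> // y; rewrite /occ /=.
by move=> /andP[_ /orP[//|/eqP->]].
Qed.

Lemma agree_states L w a : a \in states L -> agree L a w -> a = restrict_state L w.
Proof.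
move=> /statesP[tL aL] [taw oaw]; apply: Omega_eq => // y.
have [yL|yL] := boolP (y \in L); first by rewrite oaw // /occ /= yL andbT.
rewrite [in RHS]/occ /= (negPf yL) /= -taw.
have -> : (y == tag_pos a) = false by apply/eqP => yt; rewrite yt tL in yL.
by rewrite andbF; apply/negP => /aL; rewrite (negPf yL).
Qed.

Definition cyl L a : set (Omega d) := [set w | agree L a w].

Lemma measurable_tag (y : site d) : measurable [set w : Omega d | tag_pos w = y].
Proof. by apply: sub_sigma_algebra; left; exists y. Qed.

Lemma measurable_occ (y : site d) : measurable [set w : Omega d | occ w y].
Proof. by apply: sub_sigma_algebra; right; exists y. Qed.

Lemma measurable_occ_eq (y : site d) c : measurable [set w : Omega d | occ w y = c].
Proof.
case: c; first exact: measurable_occ.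
rewrite (_ : [set _ | _] = ~` [set w : Omega d | occ w y]).
  by apply: measurableC; exact: measurable_occ.
by apply/seteqP; split=> w /=; [move=> ->|move/negP/negPf].
Qed.

Lemma measurable_occ_on L (s : config d) :
  measurable [set w : Omega d | forall y, y \in L -> occ w y = s y].
Proof.
rewrite (_ : [set _ | _] = \bigcap_(y in [set` L]) [set w : Omega d | occ w y = s y]) //.
by apply: fin_bigcap_measurable => // y _; exact: measurable_occ_eq.
Qed.

Lemma measurable_cyl L a : measurable (cyl L a).
Proof.
rewrite (_ : cyl L a = [set w | tag_pos w = tag_pos a] `&`
    [set w : Omega d | forall y, y \in L -> occ w y = occ a y]).
  by apply: measurableI; [exact: measurable_tag|exact: measurable_occ_on].
by apply/seteqP; split=> w /= [tw oo]; split=> // y yL; rewrite oo.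
Qed.

End finite_states.

Section local_functions.
Variables (R : realType) (d : nat).
Implicit Types (L : {fset site d}) (g : Omega d -> R).

(** Finite dimension made explicit: the cylinder indicators are a basis, with
    the values at the representative states as coordinates. *)
Lemma local_onE L g : local_on L g ->
  g = fun w => \sum_(a <- states L) g a * \1_(cyl L a) w.
Proof.
move=> [g0 gL]; apply/funext => w.
have [wL|wL] := boolP (tag_pos w \in L); last first.
  rewrite g0 // big_seq big1 // => a /statesP[aL _].
  rewrite indicE memNset ?mulr0 // => -[aw _].
  by move: wL; rewrite -aw aL.
rewrite (big_fsetD1 (restrict_state L w)) ?restrict_states //=.
rewrite indicE mem_set ?mulr1; last exact: agree_restrict.
rewrite big_seq big1 ?addr0; first by apply/esym/gL/agree_restrict.
move=> a; rewrite !inE => /andP[/eqP aw aL].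
by rewrite indicE memNset ?mulr0 // => /(agree_states aL).
Qed.

Lemma local_on_cyl L a : tag_pos a \in L -> local_on L (\1_(cyl L a) : Omega d -> R).
Proof.
move=> aL; split=> [w wL|w w' [tw ow]].
  by rewrite indicE memNset // => -[aw _]; rewrite -aw aL in wL.
rewrite !indicE; congr ((_ : bool)%:R); apply/idP/idP => /set_mem[ta oa];
  apply/mem_set; split; rewrite ?ta // => y yL; by rewrite oa // ow.
Qed.

Lemma measurable_local L g : local_on L g -> measurable_fun setT g.
Proof.
move=> /local_onE ->; apply: measurable_sum => a.
apply: measurable_funM; last by apply: measurable_indic; exact: measurable_cyl.
exact: measurable_cst.
Qed.

Section Rintegral_local.
Variables (dW : measure_display) (W : measurableType dW).
Variables (Q : {measure set W -> \bar R}) (Q1 : Q setT = 1%E).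
Variables (X : W -> Omega d) (mX : measurable_fun setT X).

Lemma integrable_local L g : local_on L g -> Q.-integrable setT (EFin \o (g \o X)).
Proof.
move=> gl; apply: measurable_bounded_integrable => //.
- by rewrite Q1 ltry.
- by apply: measurableT_comp mX; exact: measurable_local gl.
rewrite (local_onE gl).
exists (\sum_(a <- states L) `|g a|); split; first exact: num_real.
move=> M gM w _ /=; apply: le_trans (ltW gM).
apply: le_trans (ler_norm_sum _ _ _) _; apply: ler_sum => a _.
rewrite normrM ler_piMr // indicE normr_nat lern1.
exact: leq_b1.
Qed.

(** Reduces the integral of any local function, along the process or under the
    initial law, to those of finitely many indicators. *)
Lemma Rintegral_local L g : local_on L g ->
  Rintegral Q setT (g \o X) =
  \sum_(a <- states L) g a * Rintegral Q setT (\1_(cyl L a) \o X).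
Proof.
move=> gl; rewrite [in LHS](local_onE gl) [in LHS]/comp.
have : all (fun a => tag_pos a \in L) (states L).
  by apply/allP => a /statesP[].
move: (enum_fset (states L)); elim=> [|a s IH] /= => [_|/andP[aL sL]].
  by rewrite big_nil; under eq_Rintegral do rewrite big_nil; rewrite Rintegral_cst // mul0r.
under eq_Rintegral do rewrite big_cons.
have ia b : tag_pos b \in L -> Q.-integrable setT (EFin \o (\1_(cyl L b) \o X)).
  by move=> bL; exact/integrable_local/local_on_cyl.
have ib b : tag_pos b \in L ->
    Q.-integrable setT (EFin \o (fun w => g b * \1_(cyl L b) (X w))).
  move=> bL; rewrite (_ : _ \o _ = (fun w => (g b)%:E * (\1_(cyl L b) (X w))%:E)%E).
    by apply: integrableZl => //; exact: ia.
  by apply/funext => w /=; rewrite EFinM.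
rewrite RintegralD //.
- by rewrite RintegralZl //; [rewrite IH // big_cons|exact: ia].
- exact: ib.
rewrite (_ : _ \o _ = (fun w => \sum_(b <- s) (g b * \1_(cyl L b) (X w))%:E)%E).
  move: sL; elim: s {IH} => [_|b s IH /= /andP[bL sL]].
    by under eq_fun do rewrite big_nil; exact: integrable0.
  under eq_fun do rewrite big_cons.
  by apply: integrableD => //; [exact: ib|exact: IH].
by apply/funext => w /=; rewrite sumEFin.
Qed.

Lemma Rintegral_cyl L a :
  Rintegral Q setT (\1_(cyl L a) \o X) = fine (Q (X @^-1` cyl L a)).
Proof.
rewrite /Rintegral; congr fine.
rewrite (_ : (fun w => _) = fun w => (\1_(X @^-1` cyl L a) w)%:E).
  rewrite integral_indic ?setIT // -[X in measurable X]setTI.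
  by apply: mX => //; exact: measurable_cyl.
by apply/funext => w; rewrite /comp !indicE.
Qed.

End Rintegral_local.

End local_functions.

(** * Comparison of the process with the Euler scheme *)
Section process.
Variables (R : realType) (d : nat) (dW : measure_display) (W : measurableType dW).
Variables (P : R.-pker (Omega d) ~> W) (Y : R -> W -> Omega d).
Hypothesis PY : tagged_ssep P Y.
Implicit Types (g : Omega d -> R).

Let mY t : 0 <= t -> measurable_fun setT (Y t).
Proof. by case: PY => -[mY _ _] _; exact: mY. Qed.

Lemma box_gen_local n m g w : local_on (box d m) g ->
  box_gen n g w =
  \sum_(a <- states (box d m)) g a * box_gen n (\1_(cyl (box d m) a)) w.
Proof.
move=> gl; rewrite /box_gen; under [RHS]eq_bigr do rewrite mulr_sumr.
rewrite exchange_big /=; apply: eq_bigr => e _.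
have gE v := congr1 (fun f => f v) (local_onE gl).
rewrite 2!gE -sumrB.
by apply: eq_bigr => a _; rewrite mulrBr.
Qed.

(** The generator gives the first-order expansion in h for one local function at
    a time.  The Euler iterates depend on h, so uniformity in g is needed; it
    follows from the finitely many cylinder indicators, as the coordinates of g
    lie between 0 and 1. *)
Lemma generator_step n (eps : R) : 0 < eps ->
  \forall h \near 0^'+, forall g, local_on (box d n) g ->
    (forall w, 0 <= g w <= 1) -> forall w,
    Rintegral (P w) setT (g \o Y h) <= g w + h * (box_gen n.+1 g w + eps).
Proof.
move=> eps0; case: PY => _ gen.
pose S := states (box d n); pose N : R := (size S)%:R.
have N0 : 0 <= N by exact: ler0n.
have dlt0 : 0 < eps / (N + 1) by rewrite divr_gt0 // ltr_wpDl.
have Hcyl : \forall h \near 0^'+, forall a, a \in S -> forall w,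
    `| (Rintegral (P w) setT (\1_(cyl (box d n) a) \o Y h)
        - \1_(cyl (box d n) a) w) / h
       - box_gen n.+1 (\1_(cyl (box d n) a)) w | <= eps / (N + 1).
  have /(filter_bigI (D := S)) : forall a, a \in S ->
      \forall h \near 0^'+, forall w,
    `| (Rintegral (P w) setT (\1_(cyl (box d n) a) \o Y h)
        - \1_(cyl (box d n) a) w) / h
       - box_gen n.+1 (\1_(cyl (box d n) a)) w | <= eps / (N + 1).
    move=> a /statesP[aL _]; have al := local_on_cyl R aL.
    have := gen _ (local_on_local_fun al) _ dlt0; apply: filterS => h H w.
    by rewrite -ssep_gen_local.
  by move=> H; apply: filterS H => h H a aS; exact: H.
near=> h => g gl g01 w.
have h0 : 0 < h by near: h; exact: nbhs_right_gt.
rewrite (Rintegral_local _ (mY (ltW h0)) gl); last exact: prob_kernel.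
rewrite (congr1 (fun f => f w) (local_onE gl)) (box_gen_local _ _ gl).
rewrite -/S.
pose T a := Rintegral (P w) setT (\1_(cyl (box d n) a) \o Y h).
pose I a : R := \1_(cyl (box d n) a) w.
pose B a : R := box_gen n.+1 (\1_(cyl (box d n) a)) w.
suff : \sum_(a <- S) g a * T a - \sum_(a <- S) g a * I a
       - h * \sum_(a <- S) g a * B a <= h * eps by rewrite /T /I /B; lra.
rewrite mulr_sumr -!sumrB.
apply: (@le_trans _ _ (\sum_(a <- S) h * (eps / (N + 1)))).
  rewrite big_seq [leRHS]big_seq; apply: ler_sum => a aS.
  have H : forall a, a \in S -> forall w,
    `| (Rintegral (P w) setT (\1_(cyl (box d n) a) \o Y h)
        - \1_(cyl (box d n) a) w) / h
       - box_gen n.+1 (\1_(cyl (box d n) a)) w | <= eps / (N + 1) by near: h.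
  have {H} := H a aS w; rewrite -/(T a) -/(I a) -/(B a).
  move=> /(le_trans (ler_norm _)) /(ler_wpM2l (ltW h0)).
  rewrite mulrBr mulrCA mulfV ?gt_eqF // mulr1 => H.
  move: (g01 a) => /andP[ga0 ga1].
  have X0 : 0 <= h * (eps / (N + 1)) by rewrite mulr_ge0 // ltW.
  have := ler_wpM2l ga0 H; have := ler_wpM2r X0 ga1.
  by rewrite mul1r => *; lra.
rewrite big_const_seq iter_addr_0 count_predT -mulr_natl -/N.
rewrite mulrCA ler_wpM2l ?(ltW h0)// mulrCA ler_piMr ?(ltW eps0)//.
by rewrite ler_pdivrMr ?ltr_wpDl// mul1r lerDl.
Unshelve. all: by end_near. Qed.

Lemma markov_step w (A : set (Omega d)) s t : 0 <= s -> 0 <= t -> measurable A ->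
  P w (Y (s + t) @^-1` A) = (\int[P w]_v P (Y s v) (Y t @^-1` A))%E.
Proof.
case: PY => -[_ _ mk] _ s0 t0 mA; rewrite -(mk w s t setT A) ?setTI //.
apply: sub_sigma_algebra; exists 0, setT; split => //.
by rewrite lexx.
Qed.

Lemma tag_indicE x : tag_indic R x = \1_[set w : Omega d | tag_pos w = x].
Proof.
apply/funext => w; rewrite indicE /tag_indic; congr ((_ : bool)%:R).
by apply/eqP/idP => [?|/set_mem//]; exact/mem_set.
Qed.

Lemma integral_tag_indic w x t : 0 <= t ->
  P w [set v | tag_pos (Y t v) = x] =
  (\int[P w]_v ((tag_indic R x \o Y t) v)%:E)%E.
Proof.
move=> t0; rewrite tag_indicE.
rewrite (_ : (fun v => _) =
  fun v => (\1_[set v | tag_pos (Y t v) = x] v)%:E) //.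
rewrite integral_indic ?setIT // -[X in measurable X]setTI.
exact: (mY t0 measurableT (measurable_tag x)).
Qed.

Lemma integral_local n w g t : 0 <= t -> local_on (box d n) g ->
  (\int[P w]_v ((g \o Y t) v)%:E)%E = (Rintegral (P w) setT (g \o Y t))%:E.
Proof.
move=> t0 gl; rewrite /Rintegral fineK //.
apply: integrable_fin_num => //; apply: integrable_local gl; first exact: prob_kernel.
exact: mY.
Qed.

(** By induction on the number of steps, the Markov property being applied at the
    first step: the law after one step is integrated against the bound for the
    remaining steps, and the step of the process is replaced by an Euler step.
    Each step costs h (eps + delta): the remainder of the expansion and the
    boundary of the box.  The induction starts from a single step, where the
    generator describes the law at time h directly. *)
Lemma euler_comparison n h x eps delta K : 0 < h -> h * nedges R d n <= 1 ->
  x \in box d n -> 0 <= eps -> 0 <= delta ->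
  (forall g, local_on (box d n) g -> (forall w, 0 <= g w <= 1) -> forall w,
    Rintegral (P w) setT (g \o Y h) <= g w + h * (box_gen n.+1 g w + eps)) ->
  (forall k, (k <= K)%N -> total_influence n h x k / 2 ^+ n.+1 <= delta) ->
  forall w, (P w [set v | tag_pos (Y (h * K.+1%:R) v) = x] <=
    (euler_iter n h x K.+1 w + K.+1%:R * (h * (eps + delta)))%:E)%E.
Proof.
move=> h0 h1 xb eps0 delta0 H Hd.
have gl k := local_on_euler_iter h k xb.
have g01 k := @euler_iter_range R d n h x k (ltW h0) h1.
have step k w : (k <= K)%N -> Rintegral (P w) setT (euler_iter n h x k \o Y h) <=
    euler_iter n h x k.+1 w + h * (eps + delta).
  move=> kK; apply: le_trans (H _ (gl k) (g01 k) w) _.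
  rewrite [X in _ <= X + _]/euler_iter /= -/(euler_iter n h x k) /euler.
  rewrite -addrA lerD2l -mulrDr ler_wpM2l ?(ltW h0) //.
  have := @box_gen_boundary R d n h x k w (ltW h0) h1; have := Hd k kK; lra.
have K_ind : forall k, (k <= K)%N -> forall w,
   (P w [set v | tag_pos (Y (h * k.+1%:R) v) = x] <=
    (euler_iter n h x k.+1 w + k.+1%:R * (h * (eps + delta)))%:E)%E.
  elim=> [|k IH] kK w.
    rewrite mulr1 mul1r integral_tag_indic ?(ltW h0) //.
    rewrite (@integral_local n) ?(ltW h0) ?lee_fin //; last exact: (gl 0%N).
    exact: (step 0%N).
  have -> : h * k.+2%:R = h + h * k.+1%:R by rewrite -[in LHS]natr1; ring.
  have t0 : 0 <= h * k.+1%:R by rewrite mulr_ge0 // ltW.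
  rewrite (markov_step w (ltW h0) t0 (measurable_tag x)).
  set c := k.+1%:R * (h * (eps + delta)).
  have c0 : 0 <= c by rewrite !mulr_ge0 // ?(ltW h0) // addr_ge0.
  apply: (@le_trans _ _
    (\int[P w]_v ((euler_iter n h x k.+1 (Y h v))%:E + c%:E))%E).
    apply: ge0_le_integral => //.
    - set B := Y _ @^-1` _.
      apply: (@measurableT_comp _ _ _ _ _ _ (fun a => P a B) _ (Y h));
        last exact: mY (ltW h0).
      apply: measurable_kernel; rewrite -[X in measurable X]setTI.
      exact: (mY t0 measurableT (measurable_tag x)).
    - apply: emeasurable_funD => //; apply/measurable_EFinP.
      by apply: measurableT_comp (mY (ltW h0)); exact: measurable_local (gl _).
    - by move=> v _; rewrite -EFinD; apply: IH; exact: ltnW.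
  rewrite integralD //; last 2 first.
  - apply: (@integrable_local R d _ _ (P w) _ (Y h) (mY (ltW h0)) _ _ (gl k.+1)).
    exact: prob_kernel.
  - rewrite (_ : (fun=> _) = EFin \o cst c) //.
    apply: measurable_bounded_integrable => //; last exact: bounded_cst.
    by rewrite [ltLHS]prob_kernel ltry.
  rewrite integral_cst // [X in (_ + _ * X)%E]prob_kernel mule1.
  rewrite -[X in (X + _)%E]/(\int[P w]_v ((euler_iter n h x k.+1 \o Y h) v)%:E)%E.
  rewrite (@integral_local n) ?(ltW h0) //.
  rewrite -EFinD lee_fin; apply: le_trans (lerD (step _ w kK) (lexx _)) _.
  rewrite -addrA lerD2l /c -[X in _ <= X * _]natr1; lra.
exact: K_ind.
Qed.

End process.

(** * The reversible measure *)
Section mass.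
Variables (R : realType) (d : nat).
Implicit Types (e L : {fset site d}) (a : Omega d).

Lemma perm_flip e L : (e `<=` L)%fset -> perm_eq [seq flip e y | y <- L] L.
Proof.
move=> eL; apply: uniq_perm; last 1 first.
- move=> y; apply/mapP/idP => [[z zL ->]|yL]; first by rewrite flip_stable.
  by exists (flip e y); rewrite ?flipK // flip_stable.
- by rewrite map_inj_uniq ?fset_uniq //; exact: can_inj (flipK e).
- exact: fset_uniq.
Qed.

Lemma prod_flip e L (F : site d -> R) : (e `<=` L)%fset ->
  \prod_(y <- L) F (flip e y) = \prod_(y <- L) F y.
Proof. by move=> eL; rewrite -[RHS](perm_big _ (perm_flip eL)) big_map. Qed.

Lemma sum_states_involution L (T : Omega d -> Omega d) (F : Omega d -> R) :
  involutive T -> (forall a, a \in states L -> T a \in states L) ->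
  \sum_(a <- states L) F (T a) = \sum_(a <- states L) F a.
Proof.
move=> TK TL; rewrite [RHS](perm_big [seq T a | a <- states L]) ?big_map //= perm_sym.
apply: uniq_perm; last 1 first.
- move=> a; apply/mapP/idP => [[b bL ->]|aL]; first exact: TL.
  by exists (T a); rewrite ?TK // TL.
- by rewrite map_inj_uniq ?fset_uniq //; exact: can_inj TK.
- exact: fset_uniq.
Qed.

Lemma exch_states e L a : (e `<=` L)%fset -> a \in states L -> exch e a \in states L.
Proof.
move=> eL /statesP[tL oL]; apply/statesP; split; first by rewrite tag_exch_stable.
by move=> y; rewrite occ_exch /flip_config => /oL; rewrite flip_stable.
Qed.

Lemma flip_states e L a : (e `<=` L)%fset -> a \in states L -> flip_state e a \in states L.
Proof.
move=> eL /statesP[tL oL]; apply/statesP; split; first by rewrite /tag_pos /= flip_stable.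
by move=> y; rewrite /occ /= /flip_config => /oL; rewrite flip_stable.
Qed.

Lemma flip_stateK e : involutive (@flip_state d e).
Proof.
move=> a; apply: Omega_eq; first by rewrite /tag_pos /= flipK.
by move=> y; rewrite {1}/occ /= /flip_config /= /occ /= /flip_config flipK.
Qed.

(** The product over all of L counts the tagged site with a factor rho, although
    this site is occupied with certainty; dividing by rho corrects for it and
    keeps the expression manifestly invariant under permutations of L. *)
Definition mass (rho : R) L a : R :=
  rho^-1 * \prod_(y <- L) (if occ a y then rho else 1 - rho).

Lemma mass_ge0 rho L a : 0 < rho < 1 -> 0 <= mass rho L a.
Proof.
move=> /andP[r0 r1]; rewrite mulr_ge0 ?invr_ge0 ?(ltW r0) // prodr_ge0 // => y _.
by case: ifP => _; rewrite ?subr_ge0 ltW.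
Qed.

Lemma mass_exch rho e L a : (e `<=` L)%fset -> mass rho L (exch e a) = mass rho L a.
Proof.
move=> eL; congr (_ * _); rewrite -[RHS](prod_flip _ eL).
by apply: eq_bigr => y _; rewrite occ_exch.
Qed.

Lemma mass_flip rho e L a : (e `<=` L)%fset -> mass rho L (flip_state e a) = mass rho L a.
Proof. by move=> eL; congr (_ * _); rewrite -[RHS](prod_flip _ eL). Qed.

(** The swap of x and z, here applied whatever the configuration is, carries the
    states tagged at one site to those tagged at the other. *)
Lemma mass_tag_eq rho L x z : x \in L -> z \in L ->
  \sum_(a <- states L | tag_pos a == x) mass rho L a =
  \sum_(a <- states L | tag_pos a == z) mass rho L a.
Proof.
move=> xL zL; rewrite big_mkcond [RHS]big_mkcond /=.
have eL : ([fset x; z] `<=` L)%fset.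
  by apply/fsubsetP => y; rewrite !inE => /orP[]/eqP->.
rewrite -(@sum_states_involution L _ _ (@flip_stateK [fset x; z]%fset)) /=; last first.
  by move=> a; exact: flip_states.
apply: eq_bigr => a _; rewrite mass_flip //.
have -> // : (tag_pos (flip_state [fset x; z]%fset a) == x) = (tag_pos a == z).
rewrite -[tag_pos (flip_state _ a)]/(flip [fset x; z]%fset (tag_pos a)).
apply/eqP/eqP => [tx|->]; last by rewrite fsetUC flip_edge.
by rewrite -[LHS](flipK [fset x; z]%fset) tx flip_edge.
Qed.

End mass.

(** * Growth of the weighted energy *)
Section energy.
Variables (R : realType) (d : nat) (rho : R) (n : nat).
Hypothesis rho01 : 0 < rho < 1.
Variables (phi : site d -> R) (kappa : R).
Hypothesis kappa_ge0 : 0 <= kappa.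
Hypothesis phi_nn : forall y v, v \in unit_vectors R d ->
  phi y ^+ 2 + phi (y + v) ^+ 2 <= 2 * (1 + kappa) * (phi y * phi (y + v)).
Implicit Types (g : Omega d -> R).

Let m a : R := mass rho (box d n) a * phi (tag_pos a) ^+ 2.

Definition energy g : R := \sum_(a <- states (box d n)) m a * g a ^+ 2.

Let m_ge0 a : 0 <= m a.
Proof. by rewrite mulr_ge0 ?mass_ge0 // sqr_ge0. Qed.

(** Symmetrise over the exchange.  With f, f' the weights and u, u' the values of
    g at a state and its image, the two contributions add up to
    u u' (f^2 + f'^2) - (f u)^2 - (f' u')^2.  The hypothesis on phi bounds this
    by kappa ((f u)^2 + (f' u')^2) since u and u' are nonnegative; if the tagged
    site is not on e, then f = f' and 0 is a bound. *)
Lemma edge_dirichlet_form e g : e \in edges R d n -> (forall a, 0 <= g a) ->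
  \sum_(a <- states (box d n)) m a * (g a * (g (exch e a) - g a)) <=
  kappa * \sum_(a <- states (box d n)) (tag_pos a \in e)%:R * (m a * g a ^+ 2).
Proof.
move=> /edgesP[ne eL] g0; set S := states _.
have Sinv (F : Omega d -> R) : \sum_(a <- S) F (exch e a) = \sum_(a <- S) F a.
  by apply: sum_states_involution => [|a]; [exact: exchK|exact: exch_states].
(* Twice a sum over the states is the sum of F over each pair of states that the
   exchange swaps; it is this pairing that cancels the drift. *)
have Shalf (F : Omega d -> R) :
    2 * \sum_(a <- S) F a = \sum_(a <- S) (F a + F (exch e a)).
  by rewrite big_split /= Sinv; ring.
rewrite -(ler_pM2l (ltr0Sn R 1)) mulrCA !Shalf mulr_sumr; apply: ler_sum => a _.
rewrite exchK /m mass_exch //.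
set M := mass _ _ _; have M0 : 0 <= M by exact: mass_ge0.
set f := phi (tag_pos a); set f' := phi (tag_pos (exch e a)).
set u := g a; set u' := g (exch e a).
have u0 : 0 <= u by exact: g0.
have u'0 : 0 <= u' by exact: g0.
have -> : (tag_pos (exch e a) \in e) = (tag_pos a \in e).
  by rewrite tag_exch; case: ifP => // _; rewrite flip_in.
(* No growth from an edge that does not hold the tagged site: both weights are
   then equal. *)
pose c : R := kappa * (tag_pos a \in e)%:R.
have c0 : 0 <= c by rewrite mulr_ge0 // ler0n.
have ff' : f ^+ 2 + f' ^+ 2 <= 2 * (1 + c) * (f * f').
  have same : f' = f -> f ^+ 2 + f' ^+ 2 <= 2 * (1 + c) * (f * f').
    by move=> ->; have := mulr_ge0 c0 (sqr_ge0 f); rewrite expr2; nra.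
  rewrite /f' tag_exch; case: (boolP (active e a)) => act; last first.
    by have := same; rewrite /f' tag_exch (negPf act); apply.
  have [ta|ta] := boolP (tag_pos a \in e); last first.
    by have := same; rewrite /f' tag_exch act flip_out //; apply.
  rewrite /c ta mulr1 -[X in phi X](subrK (tag_pos a)) [X in phi X]addrC.
  by apply: phi_nn; exact: flip_nn_edge.
suff : M * (u * u' * (f ^+ 2 + f' ^+ 2) - (f * u) ^+ 2 - (f' * u') ^+ 2) <=
       M * (c * ((f * u) ^+ 2 + (f' * u') ^+ 2)).
  rewrite /c; lra.
apply: ler_wpM2l => //.
have := ler_wpM2l (mulr_ge0 u0 u'0) ff'.
have : 0 <= (1 + c) * (f * u - f' * u') ^+ 2.
  by rewrite mulr_ge0 ?addr_ge0 ?sqr_ge0.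
lra.
Qed.

(** Only the edges at the tagged site contribute to the growth, whence the
    degree. *)
Lemma dirichlet_form g : (forall a, 0 <= g a) ->
  \sum_(a <- states (box d n)) m a * (g a * box_gen n g a) <=
  kappa * (degree R d)%:R * energy g.
Proof.
move=> g0; set S := states _.
have -> : \sum_(a <- S) m a * (g a * box_gen n g a) =
    \sum_(e <- edges R d n) \sum_(a <- S) m a * (g a * (g (exch e a) - g a)).
  rewrite exchange_big /=; apply: eq_bigr => a _.
  by rewrite /box_gen !mulr_sumr.
apply: (@le_trans _ _ (\sum_(e <- edges R d n)
   kappa * \sum_(a <- S) (tag_pos a \in e)%:R * (m a * g a ^+ 2))).
  by rewrite big_seq [leRHS]big_seq; apply: ler_sum => e eE; exact: edge_dirichlet_form.
rewrite -mulr_sumr -mulrA ler_wpM2l // exchange_big /= mulr_sumr.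
apply: ler_sum => a _; rewrite -mulr_suml ler_wpM2r //.
  by rewrite mulr_ge0 // sqr_ge0.
have -> : \sum_(e <- edges R d n) (tag_pos a \in e)%:R =
          \sum_(e <- edges R d n | tag_pos a \in e) (1 : R).
  by rewrite [RHS]big_mkcond; apply: eq_bigr => e _; case: ifP.
rewrite -[leRHS]mulr1; apply: sum_edges_at => // e; exact: edges_nn.
Qed.

Definition energy_defect : R := nedges R d n ^+ 2 * \sum_(a <- states (box d n)) m a.

(** The term of second order in h is the price of the explicit scheme; it
    depends on the box but vanishes as the time step goes to 0. *)
Lemma energy_euler h g : 0 <= h -> (forall a, 0 <= g a <= 1) ->
  energy (euler n h g) <=
  (1 + 2 * kappa * (degree R d)%:R * h) * energy g + h ^+ 2 * energy_defect.
Proof.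
move=> h0 g01; have g0 a : 0 <= g a by case/andP: (g01 a).
have -> : energy (euler n h g) = energy g +
    2 * h * (\sum_(a <- states (box d n)) m a * (g a * box_gen n g a)) +
    h ^+ 2 * \sum_(a <- states (box d n)) m a * box_gen n g a ^+ 2.
  rewrite /energy !mulr_sumr -!big_split /=; apply: eq_bigr => a _.
  by rewrite /euler; ring.
have H1 := ler_wpM2l h0 (dirichlet_form g0).
have H2 : \sum_(a <- states (box d n)) m a * box_gen n g a ^+ 2 <= energy_defect.
  rewrite /energy_defect mulr_sumr; apply: ler_sum => a _.
  rewrite mulrC ler_wpM2r // -[leLHS]real_normK ?num_real //.
  rewrite ler_sqr ?nnegrE ?nedges_ge0 //.
  apply: le_trans (ler_norm_sum _ _ _) _; rewrite /nedges -sum1_size natr_sum.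
  apply: ler_sum => e _; rewrite ler_norml.
  by move: (g01 a) (g01 (exch e a)) => /andP[? ?] /andP[? ?]; apply/andP; split; lra.
have := ler_wpM2l (sqr_ge0 h) H2; lra.
Qed.

Lemma energy_defect_ge0 : 0 <= energy_defect.
Proof. by rewrite mulr_ge0 ?sqr_ge0 // sumr_ge0. Qed.

Lemma energy_euler_iter h x k : 0 <= h -> h * nedges R d n <= 1 ->
  energy (euler_iter n h x k) <=
  expR (2 * kappa * (degree R d)%:R * (h * k%:R)) *
  (energy (tag_indic R x) + k%:R * (h ^+ 2 * energy_defect)).
Proof.
move=> h0 h1; set D := 2 * kappa * (degree R d)%:R.
have D0 : 0 <= D by rewrite !mulr_ge0.
have E0 : 0 <= h ^+ 2 * energy_defect by rewrite mulr_ge0 ?sqr_ge0 ?energy_defect_ge0.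
elim: k => [|k IH]; first by rewrite !(mulr0, mul0r) expR0 addr0 mul1r.
apply: le_trans (energy_euler h0 (euler_iter_range _ _ h0 h1)) _.
have e0 : 0 <= energy (tag_indic R x).
  by rewrite sumr_ge0 // => a _; rewrite mulr_ge0 ?sqr_ge0.
have kS : k.+1%:R = k%:R + 1 :> R by rewrite natr1.
rewrite -/D !kS.
have -> : D * (h * (k%:R + 1)) = D * h + D * (h * k%:R) by ring.
rewrite expRD.
set B := energy _ + _ in IH.
set B' := energy (tag_indic R x) + _.
have -> : B' = B + h ^+ 2 * energy_defect by rewrite /B /B'; ring.
have B0 : 0 <= B by rewrite addr_ge0 // mulr_ge0.
rewrite mulrDr; apply: lerD.
  apply: (@le_trans _ _ ((1 + D * h) * (expR (D * (h * k%:R)) * B))).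
    by rewrite ler_wpM2l // addr_ge0 // mulr_ge0.
  rewrite -[leRHS]mulrA ler_wpM2r ?expR_ge1Dx // mulr_ge0 // expR_ge0.
rewrite ler_peMl // -expRD; apply: le_trans (expR_ge1Dx _).
by rewrite lerDl addr_ge0 // !mulr_ge0.
Qed.

End energy.

(** * The initial law on cylinders *)
Section bernoulli.
Variables (R : realType) (d : nat) (rho : R) (mu : probability (Omega d) R).
Hypothesis rho01 : 0 < rho < 1.
Hypothesis mu0 : bernoulli_given rho 0 mu.
Variable L : {fset site d}.
Hypothesis L0 : 0 \in L.

Lemma mu_off_tag (B : set (Omega d)) : measurable B ->
  B `<=` [set w | tag_pos w != 0] -> mu B = 0%E.
Proof.
move=> mB BN; apply/eqP; rewrite -measure_le0.
have mT : measurable [set w : Omega d | tag_pos w = 0] by exact: measurable_tag.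
have <- : mu (~` [set w | tag_pos w = 0]) = 0%E.
  by rewrite probability_setC // mu0.1 subee.
apply: le_measure; rewrite ?inE //; first exact: measurableC.
by move=> w /BN /eqP.
Qed.

Lemma mu_on_tag (B : set (Omega d)) : measurable B ->
  mu (B `&` [set w | tag_pos w = 0]) = mu B.
Proof.
move=> mB.
have mT : measurable [set w : Omega d | tag_pos w = 0] by exact: measurable_tag.
rewrite [RHS](measureDI mu mB mT).
rewrite [X in (X + _)%E]mu_off_tag ?add0e //; first exact: measurableD.
by move=> w [_ /eqP].
Qed.

(** The marginals of the initial law are given on finite sets that avoid the
    origin.  Since the tagged site is almost surely there, and hence occupied,
    the condition at the origin may be dropped from the cylinder. *)
Lemma mu_cyl a : a \in states L ->
  mu (cyl L a) = (if tag_pos a == 0 then mass rho L a else 0)%:E.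
Proof.
move=> /statesP[aL oL]; case: eqP => ta; last first.
  apply: mu_off_tag; first exact: measurable_cyl.
  by move=> w [aw _]; rewrite /= -aw; exact/eqP.
pose L' := (L `\ 0)%fset.
have L'0 : 0 \notin L' by rewrite !inE eqxx.
have oa : occ a 0 by rewrite -ta; exact: (svalP a).
have -> : mass rho L a = \prod_(y <- L') (if occ a y then rho else 1 - rho).
  rewrite /mass (big_fsetD1 0) //= oa mulrA mulVf ?mul1r // gt_eqF //.
  by case/andP: rho01.
rewrite -(mu0.2 L' (occ a) L'0) -[RHS]mu_on_tag; last exact: measurable_occ_on.
congr (mu _); apply/seteqP; split=> w /=.
  by move=> [tw ow]; split; [move=> y; rewrite !inE => /andP[_ /ow]|rewrite -tw].
move=> [ow tw]; split; first by rewrite ta tw.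
move=> y yL; have [->|y0] := eqVneq y 0; last by rewrite ow // !inE y0.
by rewrite oa -{1}tw; exact/esym/(svalP w).
Qed.

Lemma Rintegral_mu (g : Omega d -> R) : local_on L g ->
  Rintegral mu setT g =
  \sum_(a <- states L | tag_pos a == 0) mass rho L a * g a.
Proof.
move=> gl; have mid : measurable_fun setT (@id (Omega d)) by exact: measurable_id.
have := Rintegral_local (@probability_setT _ _ _ mu) mid gl; rewrite /comp => ->.
rewrite [RHS]big_mkcond; apply: eq_big_seq => a aS.
have := @Rintegral_cyl R d _ _ mu idfun mid L a; rewrite /comp => ->.
rewrite [X in fine X](_ : _ = (if tag_pos a == 0 then mass rho L a else 0)%:E);
  last exact: mu_cyl.
rewrite /=.
by case: ifP; rewrite ?mulr0 // mulrC.
Qed.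

(** The masses of the states tagged at the origin are probabilities of disjoint
    cylinders under the initial law. *)
Lemma mass_tag0 : \sum_(a <- states L | tag_pos a == 0) mass rho L a <= 1.
Proof.
have gl : local_on L (fun w : Omega d => (tag_pos w \in L)%:R : R).
  by split=> [w /negPf->|w w' [-> _]].
have := Rintegral_mu gl; set S := \sum_(_ <- _ | _) (_ * _) => SE.
have -> : \sum_(a <- states L | tag_pos a == 0) mass rho L a = S.
  by apply: eq_bigr => a /eqP ta; rewrite ta L0 mulr1.
rewrite -SE; apply: (@le_trans _ _ (Rintegral mu setT (fun _ => 1 : R))).
  apply: le_Rintegral => //.
  - exact: (integrable_local (@probability_setT _ _ _ mu) (@measurable_id _ _ setT) gl).
  - exact: finite_measure_integrable_cst.
  - by move=> w _; rewrite lern1 leq_b1.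
by rewrite Rintegral_cst // [X in fine X]probability_setT mulr1.
Qed.

End bernoulli.

(** * The exponential weight *)
Section weight.
Variables (R : realType) (d : nat).

(** The left side minus 2 is the square of exp (u/2) - exp (-u/2), and this
    difference is at most 2 |u| for |u| <= 1 because exp (-v) >= 1 - v. *)
Lemma expR_cosh_le (u : R) : `|u| <= 1 -> expR u + expR (- u) <= 2 + 4 * u ^+ 2.
Proof.
wlog u0 : u / 0 <= u.
  move=> H; case: (leP 0 u) => [|/ltW] u0 u1; first exact: H.
  by have := H (- u); rewrite normrN opprK sqrrN addrC oppr_ge0; apply.
rewrite ger0_norm // => u1.
set v := u / 2; have uE : u = v + v by rewrite /v; field.
have v0 : 0 <= v by rewrite divr_ge0.
have v1 : v <= 1 / 2 by rewrite ler_pM2r ?invr_gt0.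
have e1 := expR_ge1Dx (- v).
have ev : 0 < expR v by exact: expR_gt0.
have ee : expR v * expR (- v) = 1 by exact: expRxMexpNx_1.
have e2 : expR v - expR (- v) <= 4 * v.
  have : expR v <= 1 + 2 * v.
    have E1 : expR v * (1 - v) <= 1 by have := ler_wpM2l (ltW ev) e1; rewrite ee.
    rewrite -(@ler_pM2r _ (1 - v)); last by lra.
    by apply: le_trans E1 _; nra.
  lra.
have e3 : 0 <= expR v - expR (- v) by rewrite subr_ge0 ler_expR; lra.
have e4 : (expR v - expR (- v)) ^+ 2 <= (4 * v) ^+ 2.
  by rewrite ler_sqr // nnegrE //; lra.
rewrite uE opprD !expRD.
nra.
Qed.

Definition dot (x y : site d) : R := \sum_(i < d) (x ord0 i)%:~R * (y ord0 i)%:~R.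

Lemma dotDr x y z : dot x (y + z) = dot x y + dot x z.
Proof.
by rewrite /dot -big_split; apply: eq_bigr => i _; rewrite mxE rmorphD mulrDr.
Qed.

Lemma dotNr x y : dot x (- y) = - dot x y.
Proof.
by rewrite /dot -sumrN; apply: eq_bigr => i _; rewrite mxE rmorphN mulrN.
Qed.

Lemma dot0r x : dot x 0 = 0.
Proof. by rewrite /dot big1 // => i _; rewrite mxE mulr0. Qed.

Lemma dotxx x : dot x x = eucl R x ^+ 2.
Proof. by rewrite sqr_eucl; apply: eq_bigr => i _; rewrite expr2. Qed.

(** Cauchy-Schwarz, by the inequality of the means with the weights that make it
    an equality for v parallel to x. *)
Lemma dot_le x v : eucl R v = 1 -> dot x v <= eucl R x.
Proof.
move=> v1; have [x0|x0] := eqVneq (eucl R x) 0.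
  suff xi i : (x ord0 i)%:~R = 0 :> R.
    by rewrite x0 /dot big1 // => i _; rewrite xi mul0r.
  have : \sum_(i < d) ((x ord0 i)%:~R : R) ^+ 2 == 0 by rewrite -sqr_eucl x0 expr0n.
  rewrite psumr_eq0 => [/allP/(_ i (mem_index_enum _))|? _]; last exact: sqr_ge0.
  by rewrite /= sqrf_eq0 => /eqP.
set c := eucl R x in x0 *; have c0 : 0 < c by rewrite lt0r x0 eucl_ge0.
apply: (@le_trans _ _ (\sum_(i < d)
   ((x ord0 i)%:~R ^+ 2 / (2 * c) + c / 2 * (v ord0 i)%:~R ^+ 2))).
  apply: ler_sum => i _; set p := _%:~R; set q := _%:~R.
  rewrite -subr_ge0.
  have -> : p ^+ 2 / (2 * c) + c / 2 * q ^+ 2 - p * q = (p - c * q) ^+ 2 / (2 * c).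
    by field.
  by rewrite divr_ge0 ?sqr_ge0 // mulr_ge0 // ltW.
rewrite big_split /= -mulr_suml -mulr_sumr -!sqr_eucl v1 -/c.
by rewrite le_eqVlt; apply/orP; left; apply/eqP; field.
Qed.

Lemma norm_dot_le x v : eucl R v = 1 -> `|dot x v| <= eucl R x.
Proof.
move=> v1; rewrite ler_norml dot_le // andbT lerNl -dotNr.
by apply: dot_le; rewrite euclN.
Qed.

Definition tilt (s : R) x y := expR (- (s * dot x y)).

(** A unit step changes the exponent by at most s |x|; the linear terms cancel
    and the bound on the hyperbolic cosine leaves the square. *)
Lemma tilt_nn s x y v : 0 <= s -> s * eucl R x <= 1 -> v \in unit_vectors R d ->
  tilt s x y ^+ 2 + tilt s x (y + v) ^+ 2 <=
  2 * (1 + 2 * (s * eucl R x) ^+ 2) * (tilt s x y * tilt s x (y + v)).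
Proof.
move=> s0 sx; rewrite in_unit_vectors => /eqP v1.
set u := s * dot x v.
have un : `|u| <= s * eucl R x.
  by rewrite normrM ger0_norm // ler_wpM2l // norm_dot_le.
have uu : u ^+ 2 <= (s * eucl R x) ^+ 2.
  rewrite -[leLHS]real_normK ?num_real // ler_sqr // nnegrE.
  by rewrite mulr_ge0 ?eucl_ge0.
have := expR_cosh_le (le_trans un sx).
set A := tilt s x y; have A0 : 0 < A by exact: expR_gt0.
have -> : tilt s x (y + v) = A * expR (- u).
  by rewrite /tilt dotDr mulrDr opprD expRD.
set p := expR u; set q := expR (- u).
have p0 : 0 < p by exact: expR_gt0.
have q0 : 0 < q by exact: expR_gt0.
have pq : p * q = 1 by exact: expRxMexpNx_1.
move=> H.
have -> : A ^+ 2 + (A * q) ^+ 2 = A ^+ 2 * q * (p + q).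
  by rewrite mulrDr -mulrA [q * p]mulrC pq; ring.
have -> : 2 * (1 + 2 * (s * eucl R x) ^+ 2) * (A * (A * q)) =
  A ^+ 2 * q * (2 + 4 * (s * eucl R x) ^+ 2) by ring.
by rewrite ler_wpM2l ?mulr_ge0 ?sqr_ge0 ?(ltW q0) //; lra.
Qed.

End weight.

(** * The Chernoff bound and its optimisation *)
Lemma near_right_step (R : realType) (Q : R -> Prop) (t : R) : 0 < t ->
  (\forall h \near 0^'+, Q h) -> exists K : nat, Q (t / K.+1%:R).
Proof.
move=> t0 [e /= e0 H]; exists (Num.truncn (t / e)).
set k := (Num.truncn (t / e)).+1%:R.
have k0 : 0 < k by exact: ltr0Sn.
have tk : 0 < t / k by rewrite divr_gt0.
apply: H => //=; rewrite sub0r normrN gtr0_norm //.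
by rewrite ltr_pdivrMr // mulrC -ltr_pdivrMr // truncnS_gt.
Qed.

Section chernoff.
Variables (R : realType) (d : nat) (dW : measure_display) (W : measurableType dW).
Variables (P : R.-pker (Omega d) ~> W) (Y : R -> W -> Omega d).
Hypothesis PY : tagged_ssep P Y.
Variables (rho : R) (mu : probability (Omega d) R).
Hypothesis rho01 : 0 < rho < 1.
Hypothesis mu0 : bernoulli_given rho 0 mu.

Lemma energy_tag_indic n (phi : site d -> R) x : x \in box d n ->
  energy rho n phi (tag_indic R x) <= phi x ^+ 2.
Proof.
move=> xb; have zb : 0 \in box d n by rewrite in_box supnorm0.
have -> : energy rho n phi (tag_indic R x) =
    phi x ^+ 2 * \sum_(a <- states (box d n) | tag_pos a == x) mass rho (box d n) a.
  rewrite mulr_sumr [RHS]big_mkcond; apply: eq_bigr => a _.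
  rewrite /tag_indic; case: eqP => [->|_]; last by rewrite expr0n mulr0.
  by rewrite expr1n mulr1 mulrC.
rewrite (mass_tag_eq _ xb zb) ler_piMr ?sqr_ge0 //.
exact: (mass_tag0 rho01 mu0 zb).
Qed.

(** Cauchy-Schwarz in the form g <= (g^2 / c + c) / 2; the free parameter c will
    be the bound to be proved, which avoids square roots. *)
Lemma Rintegral_mu_le_energy n (phi : site d -> R) (g : Omega d -> R) c :
  phi 0 = 1 -> 0 < c -> local_on (box d n) g ->
  Rintegral mu setT g <= (energy rho n phi g / c + c) / 2.
Proof.
move=> phi0 c0 gl; have zb : 0 \in box d n by rewrite in_box supnorm0.
rewrite (Rintegral_mu rho01 mu0 zb gl).
set S := states _; set m := mass rho _.
have m0 a : 0 <= m a by exact: mass_ge0.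
apply: (@le_trans _ _ ((\sum_(a <- S | tag_pos a == 0) m a * g a ^+ 2) / (2 * c)
    + c / 2 * \sum_(a <- S | tag_pos a == 0) m a)).
  rewrite mulr_suml mulr_sumr -big_split; apply: ler_sum => a _ /=.
  rewrite -mulrA [c / 2 * _]mulrC -mulrDr ler_wpM2l //.
  rewrite -subr_ge0.
  have -> : g a ^+ 2 / (2 * c) + c / 2 - g a = (g a - c) ^+ 2 / (2 * c).
    by field; rewrite gt_eqF.
  by rewrite divr_ge0 ?sqr_ge0 // mulr_ge0 // ltW.
have H1 : c / 2 * (\sum_(a <- S | tag_pos a == 0) m a) <= c / 2.
  rewrite ler_piMr //; first by rewrite divr_ge0 // ltW.
  exact: (mass_tag0 rho01 mu0 zb).
have H2 : \sum_(a <- S | tag_pos a == 0) m a * g a ^+ 2 <= energy rho n phi g.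
  rewrite big_mkcond; apply: ler_sum => a _; case: eqP => [->|_].
    by rewrite phi0 expr1n mulr1.
  by rewrite mulr_ge0 ?sqr_ge0 // mulr_ge0 ?sqr_ge0.
have : (\sum_(a <- S | tag_pos a == 0) m a * g a ^+ 2) / (2 * c) <=
    energy rho n phi g / (2 * c).
  by rewrite ler_wpM2r // invr_ge0 mulr_ge0 // ltW.
have -> : energy rho n phi g / (2 * c) = energy rho n phi g / c / 2.
  by field; rewrite gt_eqF.
lra.
Qed.

Lemma exists_box x (M delta : R) : 0 < delta -> 0 <= M ->
  exists n, x \in box d n /\ M / 2 ^+ n.+1 <= delta.
Proof.
move=> delta0 M0; exists (maxn (supnorm x) (Num.truncn (M / delta))).
set n := maxn _ _; split; first by rewrite in_box leq_maxl.
rewrite ler_pdivrMr ?exprn_gt0 // mulrC -ler_pdivrMr //.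
apply: (@le_trans _ _ n.+1%:R).
  apply: (le_trans (ltW (truncnS_gt _))); rewrite ler_nat ltnS; exact: leq_maxr.
by rewrite -natrX ler_nat ltnW // ltn_expl.
Qed.

(** For each eta, the box is chosen first, to make the boundary error small over
    the whole time interval; only then the time step, since the remainder of the
    generator and the energy defect depend on the box. *)
Lemma chernoff_bound s x t : 0 <= s -> s * eucl R x <= 1 -> 0 < t ->
  (\int[mu]_w P w [set v | tag_pos (Y t v) = x] <=
   (expR (2 * (degree R d)%:R * (s * eucl R x) ^+ 2 * t
          - s * eucl R x ^+ 2))%:E)%E.
Proof.
move=> s0 sx t0.
set D := (degree R d)%:R : R; have D0 : 0 <= D by exact: ler0n.
pose kappa : R := 2 * (s * eucl R x) ^+ 2.
have kappa0 : 0 <= kappa by rewrite mulr_ge0 // sqr_ge0.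
pose phi := tilt s x.
have phi_nn y v : v \in unit_vectors R d ->
    phi y ^+ 2 + phi (y + v) ^+ 2 <= 2 * (1 + kappa) * (phi y * phi (y + v)).
  exact: tilt_nn.
have phi0 : phi 0 = 1 by rewrite /phi /tilt dot0r mulr0 oppr0 expR0.
set c := expR _; have c0 : 0 < c by exact: expR_gt0.
pose T : R := expR (2 * kappa * D * t).
have T0 : 0 < T by exact: expR_gt0.
(* T bounds the growth of the squared norm and phi x the initial norm, so c
   bounds the norm at time t. *)
have cT : T * phi x ^+ 2 = c ^+ 2.
  rewrite /T /phi /tilt /c dotxx -!expRM_natl -expRD; congr expR.
  by rewrite /kappa; ring.
apply/lee_addgt0Pr => eta eta0.
have [n [xb nM]] := @exists_box x (expR (8 * D * t) * (D * 2 ^+ (supnorm x).+1))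
  (eta / (3 * t)) ltac:(by rewrite divr_gt0 // mulr_gt0)
  ltac:(by rewrite mulr_ge0 ?expR_ge0 // mulr_ge0 // exprn_ge0).
set delta := eta / (3 * t) in nM.
have delta0 : 0 < delta by rewrite divr_gt0 // mulr_gt0.
pose B := energy_defect rho n phi.
have B0 : 0 <= B by exact: energy_defect_ge0.
pose M : R := T * (t * B) / c / 2.
have M0 : 0 <= M.
  rewrite /M divr_ge0 // divr_ge0 ?(ltW c0) // mulr_ge0 ?(ltW T0) //.
  by rewrite mulr_ge0 // ltW.
pose Q (h : R) := [/\ h * nedges R d n <= 1, M * h <= eta / 3 &
   (forall g, local_on (box d n) g -> (forall w, 0 <= g w <= 1) -> forall w,
    Rintegral (P w) setT (g \o Y h) <= g w + h * (box_gen n.+1 g w + delta))].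
have [K HK] : exists K : nat, Q (t / K.+1%:R).
  apply: (@near_right_step _ Q) => //; near=> h; split.
  - have h0 : 0 < h by near: h; exact: nbhs_right_gt.
    have : h < (nedges R d n + 1)^-1.
      by near: h; apply: nbhs_right_lt; rewrite invr_gt0 ltr_wpDl // nedges_ge0.
    rewrite -(@ltr_pM2r _ (nedges R d n + 1)) ?ltr_wpDl ?nedges_ge0 // mulVf; first lra.
    by rewrite gt_eqF // ltr_wpDl ?nedges_ge0.
  - have h0 : 0 < h by near: h; exact: nbhs_right_gt.
    have : h < eta / 3 / (M + 1).
      by near: h; apply: nbhs_right_lt; rewrite !divr_gt0 // ltr_wpDl.
    by rewrite ltr_pdivlMr ?ltr_wpDl //; lra.
  - by near: h; exact: generator_step.
set h := t / K.+1%:R in HK; case: HK => h1 Mh step.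
have h0 : 0 < h by rewrite divr_gt0.
have hK : h * K.+1%:R = t by rewrite /h divfK // pnatr_eq0.
have infl k : (k <= K)%N -> total_influence n h x k / 2 ^+ n.+1 <= delta.
  move=> kK; apply: le_trans nM; rewrite ler_wpM2r ?invr_ge0 ?exprn_ge0 //.
  apply: le_trans (total_influence_le _ _ _ (ltW h0)) _.
  rewrite ler_wpM2r ?mulr_ge0 ?exprn_ge0 // ler_expR -/D ler_wpM2l ?mulr_ge0 //.
  by rewrite -hK ler_wpM2l ?(ltW h0) // ler_nat leqW.
have cmp := euler_comparison PY h0 h1 xb (ltW delta0) (ltW delta0) step infl.
rewrite hK in cmp.
set G := euler_iter n h x K.+1 in cmp.
have gl : local_on (box d n) G by exact: local_on_euler_iter.
set err := K.+1%:R * (h * (delta + delta)) in cmp.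
have errE : err = 2 * (eta / 3).
  rewrite /err mulrA [_ * h]mulrC hK /delta; field; rewrite gt_eqF //.
apply: (@le_trans _ _ (\int[mu]_w ((G w)%:E + err%:E))%E).
  apply: ge0_le_integral => //.
  - case: (PY) => -[mY _ _] _; apply: measurable_kernel.
    rewrite -[X in measurable X]setTI.
    exact: (mY t (ltW t0) measurableT _ (measurable_tag x)).
  - apply: emeasurable_funD => //; apply/measurable_EFinP; exact: measurable_local gl.
have iG := integrable_local (@probability_setT _ _ _ mu) (@measurable_id _ _ setT) gl.
rewrite integralD //; last exact: finite_measure_integrable_cst.
rewrite integral_cst // [X in (_ + _ * X)%E]probability_setT mule1.
have -> : (\int[mu]_w (G w)%:E)%E = (Rintegral mu setT G)%:E.
  by rewrite /Rintegral fineK //; exact: integrable_fin_num.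
rewrite -!EFinD lee_fin.
have := Rintegral_mu_le_energy phi0 c0 gl.
have EG : energy rho n phi G <= c ^+ 2 + T * (t * (h * B)).
  apply: le_trans (energy_euler_iter rho01 kappa0 phi_nn _ _ (ltW h0) h1) _.
  rewrite hK -/D -/T -cT -mulrDr ler_wpM2l ?(ltW T0) // lerD ?energy_tag_indic //.
  by rewrite -/B -hK expr2; lra.
have : energy rho n phi G / c <= (c ^+ 2 + T * (t * (h * B))) / c.
  by rewrite ler_wpM2r // invr_ge0 ltW.
have -> : (c ^+ 2 + T * (t * (h * B))) / c = c + 2 * (M * h).
  by rewrite /M; field; rewrite gt_eqF.
rewrite errE; lra.
Unshelve. all: by end_near. Qed.

End chernoff.

Theorem theorem1p3 (R : realType) (d : nat) (hd : (2 <= d)%N) :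
  exists C : R, 0 < C /\
  forall (dW : measure_display) (W : measurableType dW)
    (P : R.-pker (Omega d) ~> W) (Y : R -> W -> Omega d),
  tagged_ssep P Y ->
  forall rho : R, 0 < rho < 1 ->
  forall mu : probability (Omega d) R, bernoulli_given rho 0 mu ->
  forall (x : site d) (t : R), 0 < t ->
  (\int[mu]_w P w [set v | tag_pos (Y t v) = x] <=
    (if eucl R x <= t then expR (- (eucl R x ^+ 2 / (C * t)))
     else expR (- (eucl R x / C)))%:E)%E.
Proof.
set D := (degree R d)%:R : R; have D0 : 0 <= D by exact: ler0n.
pose A : R := 4 * D + 1.
have A1 : 1 <= A by rewrite lerDr mulr_ge0.
have A0 : 0 < A by exact: lt_le_trans A1.
(* With s = 1 / (A t) or 1 / (A |x|) the growth term is at most half of the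
   gain, as 2 D / A <= 1 / 2; the factor 2 in the constant pays for it. *)
exists (2 * A); split; first by rewrite mulr_gt0.
move=> dW W P Y PY rho rho01 mu mu0 x t t0.
have r0 := eucl_ge0 R x; set r := eucl R x in r0 *.
case: ifPn => [rt|]; last rewrite -ltNge => rt.
  pose s := (A * t)^-1.
  have s0 : 0 < s by rewrite invr_gt0 mulr_gt0.
  have sAt : s * (A * t) = 1 by rewrite mulVf // mulf_neq0 // gt_eqF.
  have sr : s * r <= 1.
    by rewrite -sAt ler_wpM2l ?(ltW s0) // (le_trans rt) // ler_peMl // ltW.
  apply: le_trans (chernoff_bound PY rho01 mu0 (ltW s0) sr t0) _.
  rewrite lee_fin ler_expR -/D -/r.
  have -> : r ^+ 2 / (2 * A * t) = s * r ^+ 2 / 2.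
    by rewrite /s; field; rewrite !gt_eqF.
  have : 2 * D * (s * r) ^+ 2 * t <= s * r ^+ 2 / 2.
    have -> : s * r ^+ 2 / 2 = s * (A * t) * (s * r ^+ 2 / 2) by rewrite sAt mul1r.
    have : 0 <= s ^+ 2 * r ^+ 2 * t by rewrite mulr_ge0 ?(ltW t0) // mulr_ge0 ?sqr_ge0.
    by rewrite /A; lra.
  lra.
have rp : 0 < r by exact: lt_trans rt.
pose s := (A * r)^-1.
have s0 : 0 < s by rewrite invr_gt0 mulr_gt0.
have sA : s * r = A^-1 by rewrite /s invfM -mulrA mulVf ?mulr1 // gt_eqF.
have sr : s * r <= 1 by rewrite sA invf_le1.
apply: le_trans (chernoff_bound PY rho01 mu0 (ltW s0) sr t0) _.
rewrite lee_fin ler_expR -/D -/r sA.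
have -> : s * r ^+ 2 = A^-1 * r by rewrite expr2 mulrA sA.
have -> : r / (2 * A) = A^-1 * r / 2 by field; rewrite gt_eqF.
have : 2 * D * (A^-1) ^+ 2 * t <= A^-1 * r / 2.
  have i0 : 0 < A^-1 by rewrite invr_gt0.
  have iA : A^-1 * A = 1 by rewrite mulVf // gt_eqF.
  apply: (@le_trans _ _ (2 * D * A^-1 ^+ 2 * r)).
    by rewrite ler_wpM2l ?(ltW rt) // mulr_ge0 ?sqr_ge0 // mulr_ge0.
  have -> : A^-1 * r / 2 = A^-1 * A * (A^-1 * r / 2) by rewrite iA mul1r.
  have : 0 <= A^-1 ^+ 2 * r by rewrite mulr_ge0 ?sqr_ge0.
  by move: A^-1 => B; rewrite /A; lra.
lra.
Qed.
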